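(* For each $n\ge 1$ let $\{X_{n,k};k=1,\dots,k_n\}$ be independent random variables in a sub-linear expectation space $(\Omega,\mathscr H,\hat{\mathbb E})$. Denote $\overline\sigma_{n,k}^2=\hat{\mathbb E}[X_{n,k}^2]$, $\underline\sigma_{n,k}^2=\hat{\mathcal E}[X_{n,k}^2]$ and $B_n^2=\sum_{k=1}^{k_n}\overline\sigma_{n,k}^2$, with $0<B_n<\infty$. Suppose that the Lindeberg condition is satisfied: $$\frac1{B_n^2}\sum_{k=1}^{k_n}\hat{\mathbb E}\big[(X_{n,k}^2-\epsilon B_n^2)^+\big]\to 0\quad\text{as } n\to\infty,\ \text{for all }\epsilon>0,$$ and further that there is a constant $r\in[0,1]$ such that $$\frac{\sum_{k=1}^{k_n}\big|r\overline\sigma_{n,k}^2-\underline\sigma_{n,k}^2\big|}{B_n^2}\to 0,$$ and that $$\frac{\sum_{k=1}^{k_n}\big\{|\hat{\mathbb E}[X_{n,k}]|+|\hat{\mathcal E}[X_{n,k}]|\big\}}{B_n}\to 0 .$$ Then for any bounded continuous function $\varphi:\mathbb R\to\mathbb R$, $$\lim_{n\to\infty}\hat{\mathbb E}\left[\varphi\left(\frac{\sum_{k=1}^{k_n}X_{n,k}}{B_n}\right)\right]=\widetilde{\mathbb E}[\varphi(\xi)],$$ where $\xi\sim N(0,[r,1])$ under $\widetilde{\mathbb E}$.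
   Context: Sub-linear expectation space: Let $(\Omega,\mathcal F)$ be a measurable space and $\mathscr H$ a linear space of real functions on $(\Omega,\mathcal F)$ (called random variables) such that $X_1,\dots,X_n\in\mathscr H$ implies $\varphi(X_1,\dots,X_n)\in\mathscr H$ for each $\varphi\in C_{l,Lip}(\mathbb R^n)$. Here $C_{l,Lip}(\mathbb R^n)$ is the space of functions satisfying $|\varphi(x)-\varphi(y)|\le C(1+|x|^m+|y|^m)|x-y|$ for all $x,y\in\mathbb R^n$, for some $C>0$, $m\in\mathbb N$ depending on $\varphi$. A sub-linear expectation is a function $\hat{\mathbb E}:\mathscr H\to[-\infty,\infty]$ such that for all $X,Y\in\mathscr H$: (1) $X\ge Y$ implies $\hat{\mathbb E}[X]\ge\hat{\mathbb E}[Y]$; (2) $\hat{\mathbb E}[c]=c$ for constants $c$; (3) $\hat{\mathbb E}[X+Y]\le\hat{\mathbb E}[X]+\hat{\mathbb E}[Y]$ whenever the right side is not of the form $+\infty-\infty$ or $-\infty+\infty$; (4) $\hat{\mathbb E}[\lambda X]=\lambda\hat{\mathbb E}[X]$ for $\lambda\ge0$. The triple $(\Omega,\mathscr H,\hat{\mathbb E})$ is a sub-linear expectation space. The conjugate expectation is $\hat{\mathcal E}[X]=-\hat{\mathbb E}[-X]$. If a function $X$ on $\Omega$ is not in $\mathscr H$, $\hat{\mathbb E}[X]$ denotes $\inf\{\hat{\mathbb E}[Y]:X\le Y\in\mathscr H\}$. Notation: $x^+=\max(x,0)$, $x^-=\max(-x,0)$. Independence: a random vector $\boldsymbol Y=(Y_1,\dots,Y_n)$,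 $Y_i\in\mathscr H$, is independent to $\boldsymbol X=(X_1,\dots,X_m)$, $X_i\in\mathscr H$, if for each $\varphi\in C_{l,Lip}(\mathbb R^m\times\mathbb R^n)$, $\hat{\mathbb E}[\varphi(\boldsymbol X,\boldsymbol Y)]=\hat{\mathbb E}\big[\hat{\mathbb E}[\varphi(\boldsymbol x,\boldsymbol Y)]|_{\boldsymbol x=\boldsymbol X}\big]$ whenever $\overline\varphi(\boldsymbol x):=\hat{\mathbb E}[|\varphi(\boldsymbol x,\boldsymbol Y)|]<\infty$ for all $\boldsymbol x$ and $\hat{\mathbb E}[|\overline\varphi(\boldsymbol X)|]<\infty$. Random variables $X_1,\dots,X_n$ are independent if $X_k$ is independent to $(X_1,\dots,X_{k-1})$ for each $2\le k\le n$. G-normal distribution: for $0\le\underline\sigma^2\le\overline\sigma^2<\infty$, a random variable $\xi$ in a sub-linear expectation space $(\widetilde\Omega,\widetilde{\mathscr H},\widetilde{\mathbb E})$ is $N(0,[\underline\sigma^2,\overline\sigma^2])$ distributed, written $\xi\sim N(0,[\underline\sigma^2,\overline\sigma^2])$ under $\widetilde{\mathbb E}$, if for every $\varphi\in C_{l,Lip}(\mathbb R)$ the function $u(t,x)=\widetilde{\mathbb E}[\varphi(x+\sqrt t\,\xi)]$, $t\ge0$, $x\in\mathbb R$, is the unique viscosity solution of $\partial_tu-G(\partial_{xx}^2u)=0$, $u(0,x)=\varphi(x)$, where $G(\alpha)=\frac12(\overline\sigma^2\alpha^+-\underline\sigma^2\alpha^-)$. *)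

(* Defs.v *)
From mathcomp Require Import all_boot all_order all_algebra.
From mathcomp Require Import all_classical all_reals all_analysis.

Set Implicit Arguments.
Unset Strict Implicit.
Unset Printing Implicit Defensive.

Import Order.TTheory GRing.Theory Num.Theory.
Import numFieldNormedType.Exports.

Local Open Scope classical_set_scope.
Local Open Scope ring_scope.

(* The space C_{l,Lip}(V).  On V = 'rV[R]_n the library norm is the maximum
   norm; all norms of R^n define the same class. *)
Definition C_lLip (R : realType) (V : normedZmodType R) (f : V -> R) : Prop :=
  exists (C : R) (m : nat), 0 < C /\
    forall x y : V,
      `|f x - f y| <= C * (1 + `|x| ^+ m + `|y| ^+ m) * `|x - y|.

Definition rvec (R : realType) (T : Type) (n : nat) (X : 'I_n -> T -> R)
  (w : T) : 'rV[R]_n := \row_i X i w.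

(* [rv] is the space H.  The functional [E0] is meaningful only on [rv]: no axiom
   constrains it elsewhere, and [expect] below never reads it elsewhere.  With
   the convention 0 * oo = 0, [E0_scale] at 0 agrees with [E0_cst]. *)
Record sublinear_expectation (R : realType) (d : measure_display)
    (Omega : measurableType d) := SublinearExpectation {
  rv : set (Omega -> R);
  E0 : (Omega -> R) -> \bar R;
  rv_zero : rv (fun=> 0);
  rv_add : forall X Y, rv X -> rv Y -> rv (fun w => X w + Y w);
  rv_scale : forall (a : R) X, rv X -> rv (fun w => a * X w);
  rv_lLip : forall (n : nat) (X : 'I_n.+1 -> Omega -> R)
      (f : 'rV[R]_n.+1 -> R),
    (forall i, rv (X i)) -> C_lLip f -> rv (fun w => f (rvec X w));
  E0_mono : forall X Y, rv X -> rv Y ->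
    (forall w, Y w <= X w) -> (E0 Y <= E0 X)%E;
  E0_cst : forall c : R, E0 (fun=> c) = c%:E;
  E0_subadd : forall X Y, rv X -> rv Y -> (E0 X +? E0 Y)%E ->
    (E0 (fun w => (X w + Y w)%R) <= E0 X + E0 Y)%E;
  E0_scale : forall (a : R) X, rv X -> 0 <= a ->
    E0 (fun w => (a * X w)%R) = (a%:E * E0 X)%E
}.

Section SublinearExpectation.
Context (R : realType) (d : measure_display) (Omega : measurableType d).
Variable S : sublinear_expectation R Omega.

Definition expect (X : Omega -> R) : \bar R :=
  if `[< rv S X >] then E0 S X
  else ereal_inf [set E0 S Y | Y in [set Y | rv S Y /\ forall w, X w <= Y w]].

Definition conj_expect (X : Omega -> R) : \bar R :=
  (- expect (fun w => (- X w)%R))%E.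

(* [Y] is independent to [X].  The integrability condition makes
   [expect (f (x, Y))] and [expect `|f (x, Y)|] finite for every [x], so that
   [fine] loses no information. *)
Definition independent_to (n m : nat) (Y : 'I_n -> Omega -> R)
    (X : 'I_m -> Omega -> R) : Prop :=
  forall f : 'rV[R]_(m + n) -> R, C_lLip f ->
    let fbar x := expect (fun w => `|f (row_mx x (rvec Y w))|) in
    (forall x : 'rV[R]_m, (fbar x < +oo)%E) ->
    (expect (fun w => `|fine (fbar (rvec X w))|%R) < +oo)%E ->
    expect (fun w => f (row_mx (rvec X w) (rvec Y w))) =
    expect (fun w => fine (expect (fun w' =>
                             f (row_mx (rvec X w) (rvec Y w'))))).

Definition independent_rvs (n : nat) (X : 'I_n -> Omega -> R) : Prop :=
  (forall k, rv S (X k)) /\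
  forall k : 'I_n, (0 < k)%N ->
    independent_to (fun _ : 'I_1 => X k)
      (fun i : 'I_k => X (widen_ord (ltnW (ltn_ord k)) i)).

End SublinearExpectation.

Section GHeat.
Context (R : realType).
Implicit Types (u psi : R -> R -> R) (G phi : R -> R) (t x : R).

Definition Gfun (lo hi a : R) : R :=
  2^-1 * (hi * Num.max a 0 - lo * Num.max (- a) 0).

Definition dt psi t x : R := derive1 (fun s => psi s x) t.
Definition dx psi t x : R := derive1 (psi t) x.
Definition dxx psi t x : R := derive1 (dx psi t) x.

Definition C12 psi : Prop := forall t x, 0 < t ->
  [/\ derivable (fun s => psi s x) t 1, derivable (psi t) x 1
    & derivable (dx psi t) x 1] /\
  [/\ {for (t, x), continuous (fun p => dt psi p.1 p.2)},
      {for (t, x), continuous (fun p => dx psi p.1 p.2)}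
    & {for (t, x), continuous (fun p => dxx psi p.1 p.2)}].

Definition visc_subsolution G u : Prop :=
  forall psi, C12 psi -> forall t x, 0 < t ->
    (\forall p \near (t, x),
       u p.1 p.2 - psi p.1 p.2 <= u t x - psi t x) ->
    dt psi t x - G (dxx psi t x) <= 0.

Definition visc_supersolution G u : Prop :=
  forall psi, C12 psi -> forall t x, 0 < t ->
    (\forall p \near (t, x),
       u t x - psi t x <= u p.1 p.2 - psi p.1 p.2) ->
    0 <= dt psi t x - G (dxx psi t x).

(* Viscosity solutions on [0, oo) x R; values at negative times are
   irrelevant. *)
Definition visc_solution G phi u : Prop :=
  [/\ {within [set p : R * R | 0 <= p.1], continuous (fun p => u p.1 p.2)},
      visc_subsolution G u, visc_supersolution G u
    & forall x, u 0 x = phi x].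

Definition poly_growth u : Prop :=
  forall T : R, 0 < T -> exists (C : R) (m : nat), forall t x,
    0 <= t <= T -> `|u t x| <= C * (1 + `|x| ^+ m).

(* Uniqueness is meant among functions of polynomial growth in space, locally
   uniformly in time.  Without a growth restriction it fails, already for the
   heat equation (Tychonoff). *)
Definition unique_visc_solution G phi u : Prop :=
  [/\ visc_solution G phi u, poly_growth u
    & forall v, visc_solution G phi v -> poly_growth v ->
        forall t x, 0 <= t -> v t x = u t x].

End GHeat.

(* [xi] is N(0, [lo, hi]) distributed; [lo] and [hi] are the variances. *)
Definition Gnormal (R : realType) (d : measure_display)
    (Omega : measurableType d) (S : sublinear_expectation R Omega)
    (lo hi : R) (xi : Omega -> R) : Prop :=
  [/\ 0 <= lo <= hi, rv S xi
    & forall phi : R -> R, C_lLip phi ->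
        let u t x := expect S (fun w => phi (x + Num.sqrt t * xi w)) in
        (forall t x, 0 <= t -> u t x \is a fin_num) /\
        unique_visc_solution (Gfun lo hi) phi (fun t x => fine (u t x))].

(* Main.v *)
(* For a bounded Lipschitz phi, independence writes E[phi(S_n / B_n)] as the
   value at 0 of the backward recursion U_0 = phi,
   U_{k+1}(y) = E[U_k(y + X / B_n)], X running through the row from its end.
   This is a monotone scheme for u_t = G(u_xx) with time step E[X^2] / B_n^2;
   its consistency error is only small when summed over the row.  Repeating the
   row periodically defines the scheme for all times.  The recursions are
   uniformly bounded and equicontinuous (a barrier sqrt(del^2 + y^2) gives the
   time regularity), so they converge locally uniformly along every ultrafilter
   on nat.  The limit v is a viscosity solution: if a parabola P touched v
   strictly from above at (t0, x0) with P_t >= G(P_xx), an induction over the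
   steps of the scheme would propagate the gap between v and P from the
   parabolic boundary of a small cylinder to (t0, x0), the jumps out of the
   cylinder being controlled by the Lindeberg condition.  Uniqueness of the
   viscosity solution, part of the definition of the G-normal law, identifies
   v(1, 0) with E[phi(xi)].  No regularity theory for the G-heat equation is
   used.  Bounded continuous functions follow by inf-convolution, tightness
   being read off the convergence for a Lipschitz cutoff. *)
Require Import Defs.
From mathcomp Require Import all_boot all_order all_algebra.
From mathcomp Require Import all_classical all_reals all_analysis.
From mathcomp Require Import ring lra.

Set Implicit Arguments.
Unset Strict Implicit.
Unset Printing Implicit Defensive.

Import Order.TTheory GRing.Theory Num.Theory.
Import numFieldNormedType.Exports.

Local Open Scope classical_set_scope.
Local Open Scope ring_scope.

(** * Sublinear expectations on integrable variables *)

Lemma coord_le_norm (R : realType) n (z : 'rV[R]_n) i : `|z 0 i| <= `|z|.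
Proof. by rewrite {2}/Num.norm/= mx_normrE; exact: (le_bigmax _ _ (0, i)). Qed.

Section SublinearReal.
Context (R : realType) (d : measure_display) (Omega : measurableType d).
Variable S : sublinear_expectation R Omega.
Implicit Types (X Y : Omega -> R) (f g : R -> R).

Lemma lip_C_lLip (V : normedZmodType R) (f : V -> R) (L : R) :
  (forall x y, `|f x - f y| <= L * `|x - y|) -> C_lLip f.
Proof.
move=> Lf; exists (`|L| + 1), 0%N; split=> [|x y].
  by rewrite ltr_wpDl.
apply: (le_trans (Lf x y)); apply: ler_wpM2r => //.
rewrite !expr0; have := ler_norm L; have := normr_ge0 L; lra.
Qed.

Lemma sqr_C_lLip : C_lLip (fun x : R => x ^+ 2).
Proof.
exists 1, 1%N; split=> // x y.
rewrite !expr1 subr_sqr normrM mulrC mul1r; apply: ler_wpM2r => //.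
by apply: (le_trans (ler_normD _ _)); rewrite -addrA ler_wpDl.
Qed.

Lemma maxB_lip (c x y : R) :
  `|Num.max (x - c) 0 - Num.max (y - c) 0| <= `|x - y|.
Proof.
rewrite /Num.max; case: ifPn; case: ifPn; rewrite -?leNgt => h1 h2.
- by rewrite subr0 normr0.
- by rewrite sub0r normrN ger0_norm // ler_normr; apply/orP; right; lra.
- by rewrite subr0 ger0_norm // ler_normr; apply/orP; left; lra.
- by rewrite (_ : x - c - (y - c) = x - y) //; ring.
Qed.

Lemma sqr_excess_C_lLip (c : R) :
  C_lLip (fun x : R => Num.max (x ^+ 2 - c) 0).
Proof.
have [C [m [C0 H]]] := sqr_C_lLip; exists C, m; split=> // x y.
exact: le_trans (maxB_lip _ _ _) (H x y).
Qed.

Lemma rv_comp f X : C_lLip f -> rv S X -> rv S (fun w => f (X w)).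
Proof.
move=> [C [m [C0 fC]]] rX.
pose g (z : 'rV[R]_1) := f (z 0 0).
have -> : (fun w => f (X w)) = (fun w => g (rvec (fun _ : 'I_1 => X) w)).
  by apply/funext => w; rewrite /g mxE.
apply: (@rv_lLip _ _ _ S 0 (fun _ : 'I_1 => X) g) => //.
have N1 (z : 'rV[R]_1) : `|z| = `|z 0 0|.
  apply/eqP; rewrite eq_le coord_le_norm andbT /Num.norm/= mx_normrE.
  by apply: bigmax_le => [|[k l] _ /=]; [exact: normr_ge0|rewrite !ord1].
by exists C, m; split=> // x y; rewrite !N1 !mxE; exact: fC.
Qed.

(** The record places only the zero variable in H; other constants arise by composing it with
    constant, hence Lipschitz, functions. *)
Lemma rv_cst (c : R) : rv S (fun=> c).
Proof.
rewrite (_ : (fun=> c) = fun w => (fun=> c) ((fun=> 0 : R) w : R)) //.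
apply: rv_comp (rv_zero S); apply: (@lip_C_lLip _ _ 0) => x y.
by rewrite subrr normr0 mul0r.
Qed.

Lemma rv_abs X : rv S X -> rv S (fun w => `|X w|).
Proof.
apply: rv_comp; apply: (@lip_C_lLip _ _ 1) => x y; rewrite mul1r.
exact: ler_dist_dist.
Qed.

(** On this class the functional is finite, so that [ee] turns the extended-real axioms into real
    inequalities. *)
Definition finrv X := rv S X /\ (E0 S (fun w => `|X w|%R) < +oo)%E.
Definition ee X : R := fine (E0 S X).

Lemma finrv_dom X Y : rv S X -> finrv Y -> (forall w, `|X w| <= Y w) -> finrv X.
Proof.
move=> rX [rY fY] XY; split=> //; apply: le_lt_trans fY.
apply: E0_mono; [exact: rv_abs|exact: rv_abs|] => w.
exact: le_trans (XY w) (ler_norm _).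
Qed.

(** The value +oo is excluded by X <= |X|. The value -oo is excluded by 0 <= E[X + |X|] <= E[X] +
    E[|X|], where E[|X|] is finite. *)
Lemma finrvE X : finrv X -> E0 S X = (ee X)%:E.
Proof.
move=> [rX fX]; rewrite /ee fineK //.
have rA := rv_abs rX.
have A0 : (0%:E <= E0 S (fun w => `|X w|%R))%E.
  by rewrite -(E0_cst S); apply: E0_mono => //; exact: rv_cst.
have fA : E0 S (fun w => `|X w|%R) \is a fin_num.
  by rewrite fin_numE gt_eqF ?lt_eqF //; apply: lt_le_trans A0; rewrite ltNyr.
rewrite fin_numE; apply/andP; split; last first.
  rewrite lt_eqF //; apply: le_lt_trans fX.
  by apply: E0_mono => // w; exact: ler_norm.
have : (E0 S (fun w => (X w + `|X w|)%R) <= E0 S X + E0 S (fun w => `|X w|%R))%E.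
  by apply: E0_subadd => //; rewrite adde_defC fin_num_adde_defr.
have : (0%:E <= E0 S (fun w => (X w + `|X w|)%R))%E.
  rewrite -(E0_cst S); apply: E0_mono; [exact: rv_add|exact: rv_cst|].
  by move=> w; have := ler_norm (- X w); rewrite normrN; lra.
move=> h1 h2; apply/eqP => XN; move: (le_trans h1 h2); rewrite XN.
by move: fA; case: (E0 S _).
Qed.

Lemma finrv_cst c : finrv (fun=> c).
Proof. by split; [exact: rv_cst|rewrite E0_cst ltry]. Qed.

Lemma finrvN X : finrv X -> finrv (fun w => - X w).
Proof.
move=> [rX fX]; split.
  have := rv_scale (-1) rX; congr rv.
  by apply/funext => w; rewrite mulN1r.
by rewrite (_ : (fun w => _) = (fun w => `|X w|)) //; apply/funext => w; rewrite normrN.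
Qed.

Lemma finrv_abs X : finrv X -> finrv (fun w => `|X w|).
Proof.
move=> [rX fX]; split; first exact: rv_abs.
by rewrite (_ : (fun w => _) = (fun w => `|X w|)) //; apply/funext => w; rewrite normr_id.
Qed.

Lemma finrvD X Y : finrv X -> finrv Y -> finrv (fun w => X w + Y w).
Proof.
move=> fX fY; split; first exact: rv_add fX.1 fY.1.
have [rX' rY'] := (rv_abs fX.1, rv_abs fY.1).
have eX := finrvE (finrv_abs fX); have eY := finrvE (finrv_abs fY).
apply: (@le_lt_trans _ _ (E0 S (fun w => (`|X w| + `|Y w|)%R))).
  apply: E0_mono; [exact: rv_add|exact: rv_abs (rv_add fX.1 fY.1)|].
  by move=> w; exact: ler_normD.
apply: (le_lt_trans (E0_subadd rX' rY' _)); rewrite eX eY //.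
by rewrite -EFinD ltry.
Qed.

Lemma finrvZ a X : finrv X -> finrv (fun w => a * X w).
Proof.
move=> fX; split; first exact: rv_scale fX.1.
rewrite (_ : (fun w => _) = (fun w => `|a| * `|X w|)); last first.
  by apply/funext => w; rewrite normrM.
rewrite E0_scale //; last exact: rv_abs fX.1.
by rewrite (finrvE (finrv_abs fX)) -EFinM ltry.
Qed.

Lemma ee_cst c : ee (fun=> c) = c.
Proof. by rewrite /ee E0_cst. Qed.

Lemma ee_le X Y : finrv X -> finrv Y -> (forall w, X w <= Y w) -> ee X <= ee Y.
Proof.
move=> fX fY XY; rewrite -lee_fin -!finrvE //.
exact: E0_mono fY.1 fX.1 XY.
Qed.

Lemma eeD X Y : finrv X -> finrv Y -> ee (fun w => X w + Y w) <= ee X + ee Y.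
Proof.
move=> fX fY; rewrite -lee_fin EFinD -!finrvE //; last exact: finrvD.
by apply: E0_subadd fX.1 fY.1 _; rewrite !finrvE.
Qed.

Lemma eeZ a X : 0 <= a -> finrv X -> ee (fun w => a * X w) = a * ee X.
Proof.
move=> a0 fX; apply: EFin_inj; rewrite EFinM -!finrvE //; last exact: finrvZ.
exact: E0_scale fX.1 a0.
Qed.

(** Subadditivity is applied twice: to X and c, then to X + c and -c. *)
Lemma eeDc X c : finrv X -> ee (fun w => X w + c) = ee X + c.
Proof.
move=> fX; apply/eqP; rewrite eq_le; apply/andP; split.
  by apply: (le_trans (eeD fX (finrv_cst c))); rewrite ee_cst.
have fXc := finrvD fX (finrv_cst c).
have := eeD fXc (finrv_cst (- c)); rewrite ee_cst.
rewrite (_ : (fun w => X w + c + - c) = X); first lra.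
by apply/funext => w; rewrite addrK.
Qed.

Lemma expect_rv X : rv S X -> expect S X = E0 S X.
Proof. by move=> rX; rewrite /expect asboolT. Qed.

Lemma expect_fin X : finrv X -> expect S X = (ee X)%:E.
Proof. by move=> fX; rewrite expect_rv ?finrvE //; case: fX. Qed.

(** X may lie outside H, where [expect] is an infimum over majorants: Z is one of them, and each of
    them dominates Y. *)
Lemma expect_sandwich X Y Z : finrv Y -> finrv Z ->
  (forall w, Y w <= X w <= Z w) -> ((ee Y)%:E <= expect S X <= (ee Z)%:E)%E.
Proof.
move=> fY fZ XYZ; rewrite /expect; case: asboolP => rX.
  rewrite -!finrvE //; apply/andP; split.
    by apply: E0_mono fY.1 _ => // w; case/andP: (XYZ w).
  by apply: E0_mono rX _ => // [|w]; [case: fZ|case/andP: (XYZ w)].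
apply/andP; split.
  apply: le_ereal_inf_tmp => _ [V [rV XV] <-]; rewrite -finrvE //.
  by apply: E0_mono fY.1 _ => // w; case/andP: (XYZ w) => /le_trans + _; apply.
rewrite -finrvE //; apply: ereal_inf_lbound; exists Z => //; split.
  by case: fZ.
by move=> w; case/andP: (XYZ w).
Qed.

Lemma finrv_bounded f X (K : R) : C_lLip f -> (forall x, `|f x| <= K) -> rv S X ->
  finrv (fun w => f (X w)).
Proof.
move=> Cf fK rX; apply: (finrv_dom (rv_comp Cf rX) (finrv_cst K)) => w.
exact: fK.
Qed.

End SublinearReal.

(** * The nonlinearity G *)

Section GfunTheory.
Context (R : realType).
Implicit Types lo hi q : R.

Lemma Gfun_ge0 lo hi q : 0 <= q -> Gfun lo hi q = 2^-1 * hi * q.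
Proof. by move=> q0; rewrite /Gfun max_l // max_r ?oppr_le0 //; ring. Qed.

Lemma Gfun_le0 lo hi q : q <= 0 -> Gfun lo hi q = 2^-1 * lo * q.
Proof. by move=> q0; rewrite /Gfun max_r // max_l ?oppr_ge0 //; ring. Qed.

(** Reflection exchanges the two variances. Statements on supersolutions thus reduce to statements
    on subsolutions of the swapped equation, which is why [lo <= hi] is never imposed on schemes. *)
Lemma GfunN lo hi q : Gfun lo hi (- q) = - Gfun hi lo q.
Proof. by rewrite /Gfun opprK; ring. Qed.

(** G is piecewise linear with slopes [lo / 2] and [hi / 2], both below 1. This absorbs small
    changes of curvature. *)
Lemma GfunD_le lo hi q c : 0 <= lo <= 1 -> 0 <= hi <= 1 -> 0 <= c ->
  Gfun lo hi (q + c) <= Gfun lo hi q + c.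
Proof.
move=> /andP[l0 l1] /andP[h0 h1] c0.
case: (lerP 0 (q + c)) => qc; case: (lerP 0 q) => q0.
- by rewrite !Gfun_ge0 //; nra.
- by rewrite Gfun_ge0 // (Gfun_le0 _ _ (ltW q0)); nra.
- lra.
- by rewrite !Gfun_le0 ?(ltW q0) ?(ltW qc) //; nra.
Qed.

End GfunTheory.

(** * Consistency of one step with the G-heat equation *)

Section OneStep.
Context (R : realType) (d : measure_display) (Omega : measurableType d).
Variable S : sublinear_expectation R Omega.
Local Notation ee := (ee S).
Local Notation finrv := (finrv S).

Lemma finrv_sqr (h : Omega -> R) : rv S h -> finrv (fun w => h w ^+ 2) -> finrv h.
Proof.
move=> rh fh; apply: (finrv_dom rh (finrvD fh (finrv_cst S 1))) => w.
rewrite -real_normK ?num_real //; have := sqr_ge0 (`|h w| - 1).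
have := normr_ge0 (h w); nra.
Qed.

Variables (h : Omega -> R) (r m v l eps : R).
Hypotheses (rh : rv S h) (fh : finrv (fun w => h w ^+ 2)) (eps0 : 0 < eps).
Local Notation s := (ee (fun w => h w ^+ 2)).
Local Notation pen := (fun w => Num.max (h w ^+ 2 - eps) 0).
Hypotheses (hm : `|ee h| <= m) (hmN : `|ee (fun w => - h w)| <= m)
  (hv : `|r * s + ee (fun w => - (h w ^+ 2))| <= v) (hl : ee pen <= l).

Let fh1 : finrv h. Proof. exact: finrv_sqr. Qed.

Lemma finrv_sqr_excess : finrv pen.
Proof.
apply: (finrv_dom (rv_comp (sqr_excess_C_lLip eps) rh) fh) => w.
rewrite /Num.max; case: ifPn => [_|]; first by rewrite normr0 sqr_ge0.
by rewrite -leNgt => /ger0_norm ->; move: (eps0); lra.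
Qed.

Let fpen := finrv_sqr_excess.

(** Homogeneity holds for nonnegative factors only; for p < 0 one writes p h = (-p)(-h), so both the
    upper and the lower mean enter. *)
Let ee_lin (p : R) : ee (fun w => p * h w) <= `|p| * m.
Proof.
case: (leP 0 p) => p0.
  rewrite eeZ // ger0_norm //; apply: ler_wpM2l => //.
  exact: le_trans (ler_norm _) hm.
rewrite (_ : (fun w => _) = (fun w => - p * - h w)); last first.
  by apply/funext => w; rewrite mulrNN.
rewrite eeZ ?oppr_ge0 ?(ltW p0) //; last exact: finrvN.
rewrite ltr0_norm //; apply: ler_wpM2l; first by rewrite oppr_ge0 ltW.
exact: le_trans (ler_norm _) hmN.
Qed.

(** For q >= 0 the two sides agree exactly. For q < 0 the lower variance appears in place of
    [r * s], and [v] bounds their gap. *)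
Let ee_quad (q : R) : `|ee (fun w => 2^-1 * q * h w ^+ 2) - s * Gfun r 1 q| <= `|q| * v.
Proof.
case: (lerP 0 q) => q0.
  rewrite (Gfun_ge0 _ _ q0) eeZ ?mulr_ge0 //.
  rewrite (_ : _ - _ = 0) ?normr0; last ring.
  by rewrite mulr_ge0 //; exact: le_trans hv.
rewrite (_ : (fun w => _) = (fun w => 2^-1 * - q * - (h w ^+ 2))); last first.
  by apply/funext => w; ring.
rewrite (Gfun_le0 _ _ (ltW q0)) eeZ; [|lra|exact: finrvN].
rewrite (_ : _ - _ = 2^-1 * - q * (r * s + ee (fun w => - h w ^+ 2))); last ring.
rewrite normrM (ltr0_norm q0) (ger0_norm (_ : 0 <= 2^-1 * - q)); last lra.
apply: ler_pM => //; lra.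
Qed.

(** Subadditivity splits the majorant into its four terms, which are estimated separately. *)
Lemma one_step_le (F : Omega -> R) (A p q C : R) : finrv F -> 0 <= C ->
  (forall w, F w <= A + p * h w + 2^-1 * q * h w ^+ 2 + C * Num.max (h w ^+ 2 - eps) 0) ->
  ee F <= A + s * Gfun r 1 q + `|p| * m + `|q| * v + C * l.
Proof.
move=> fF C0 FA.
have f1 := finrv_cst S A; have f2 := finrvZ p fh1.
have f3 := finrvZ (2^-1 * q) fh; have f4 := finrvZ C fpen.
have f12 := finrvD f1 f2; have f123 := finrvD f12 f3.
apply: (le_trans (ee_le fF (finrvD f123 f4) FA)).
apply: (le_trans (eeD f123 f4)).
have h3 := eeD f12 f3; have h2 := eeD f1 f2.
have h4 : ee (fun w => C * Num.max (h w ^+ 2 - eps) 0) <= C * l by rewrite eeZ // ler_wpM2l.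
have := ee_quad q; have := ee_lin p; rewrite ee_cst in h2.
rewrite ler_norml; lra.
Qed.

(** The bound concerns -E[F], which is at most E[-F]. The quadratic term is moved to the other side,
    -q h^2 / 2 <= F + A + p h + C (h^2 - eps)^+, before taking expectations; its expectation is
    close to s G(-q), whose negative is s times the swapped G at q. *)
Lemma one_step_ge (F : Omega -> R) (A p q C : R) : finrv F -> 0 <= C ->
  (forall w, - F w <= A + p * h w + 2^-1 * q * h w ^+ 2 + C * Num.max (h w ^+ 2 - eps) 0) ->
  - ee F <= A + s * Gfun 1 r q + `|p| * m + `|q| * v + C * l.
Proof.
move=> fF C0 FA.
have f1 := finrv_cst S A; have f2 := finrvZ p fh1.
have f3 := finrvZ (2^-1 * - q) fh; have f4 := finrvZ C fpen.
have f01 := finrvD fF f1; have f012 := finrvD f01 f2.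
have h0 : ee (fun w => 2^-1 * - q * h w ^+ 2) <=
    ee (fun w => F w + A + p * h w + C * Num.max (h w ^+ 2 - eps) 0).
  by apply: ee_le f3 (finrvD f012 f4) _ => w; have := FA w; lra.
have h4 := eeD f012 f4; have h3 := eeD f01 f2; have h2 := eeD fF f1.
have h5 : ee (fun w => C * Num.max (h w ^+ 2 - eps) 0) <= C * l by rewrite eeZ // ler_wpM2l.
have GN : Gfun 1 r q = - Gfun r 1 (- q) by rewrite GfunN opprK.
have := ee_quad (- q); have := ee_lin p; rewrite ee_cst in h2.
rewrite GN normrN ler_norml; lra.
Qed.

End OneStep.

(** * Monotone schemes *)

Section Scheme.
Context (R : realType).
Implicit Types (W : nat -> R -> R) (s : nat -> R) (e : R -> nat -> R).

(* One time step of length [s k] of a monotone scheme for the equation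
   u_t = G(u_xx), with consistency error [e eps k]; [eps] is the Lindeberg
   truncation level. *)
Definition substep (lo hi : R) W s e := forall k y A p q C eps,
  0 <= C -> 0 < eps ->
  (forall h, W k (y + h) <=
     A + p * h + 2^-1 * q * h ^+ 2 + C * Num.max (h ^+ 2 - eps) 0) ->
  W k.+1 y <= A + s k * Gfun lo hi q + (`|p| + `|q| + C) * e eps k.

(** Applied to step lengths, this is the time reached after k steps; applied to errors, the error
    accumulated until then. *)
Definition psum s k := \sum_(j < k) s j.

Lemma psum0 s : psum s 0 = 0. Proof. by rewrite /psum big_ord0. Qed.

Lemma psumS s k : psum s k.+1 = psum s k + s k.
Proof. by rewrite /psum big_ord_recr. Qed.

Lemma psum_le s k k' : (forall j, 0 <= s j) -> (k <= k')%N -> psum s k <= psum s k'.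
Proof.
move=> s0 /subnK <-; elim: (k' - k)%N => // i IH.
by rewrite addSn psumS ler_wpDr.
Qed.

Lemma psum_ge0 s k : (forall j, 0 <= s j) -> 0 <= psum s k.
Proof. by move=> s0; rewrite -(psum0 s) psum_le. Qed.

Lemma norm_le_hypot (del z : R) : `|z| <= Num.sqrt (del ^+ 2 + z ^+ 2).
Proof. by rewrite -sqrtr_sqr ler_wsqrtr // ler_wpDl ?sqr_ge0. Qed.

(** The smoothed absolute value lies below a tangent parabola of curvature 1/b <= 1/del: with c the
    value at z + h, that parabola equals (b^2 + c^2) / (2 b), which is at least c. *)
Lemma hypot_tangent (del z h : R) : 0 < del ->
  let b := Num.sqrt (del ^+ 2 + z ^+ 2) in
  Num.sqrt (del ^+ 2 + (z + h) ^+ 2) <= b + z / b * h + 2^-1 * del^-1 * h ^+ 2.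
Proof.
move=> d0 /=; set b := Num.sqrt (_ + z ^+ 2); set c := Num.sqrt _.
have b2 : b ^+ 2 = del ^+ 2 + z ^+ 2 by rewrite sqr_sqrtr // addr_ge0 ?sqr_ge0.
have c2 : c ^+ 2 = del ^+ 2 + (z + h) ^+ 2 by rewrite sqr_sqrtr // addr_ge0 ?sqr_ge0.
have db : del <= b.
  by rewrite -(ger0_norm (ltW d0)) -sqrtr_sqr ler_wsqrtr // ler_wpDr ?sqr_ge0.
have b0 : 0 < b by exact: lt_le_trans db.
apply: (@le_trans _ _ (b + z / b * h + 2^-1 * b^-1 * h ^+ 2)); last first.
  by rewrite lerD2l ler_wpM2r ?sqr_ge0 // ler_wpM2l // lef_pV2.
rewrite (_ : _ + _ = (b ^+ 2 + c ^+ 2) / (2 * b)); last first.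
  rewrite c2 (_ : (b ^+ 2 + _) = b ^+ 2 + (b ^+ 2 + 2 * z * h + h ^+ 2)); last first.
    by rewrite b2; ring.
  by field; rewrite gt_eqF.
rewrite ler_pdivlMr ?mulr_gt0 //; have := sqr_ge0 (b - c); lra.
Qed.

(** The Lipschitz bound places W k below W k x + L b(y - x), with b the smoothed absolute value.
    Each step raises this barrier by at most L / (2 del) times its length plus the error; at y = x
    the barrier exceeds its vertex constant by L del. *)
Lemma substep_time_le lo hi W s e (L del : R) : substep lo hi W s e -> hi <= 1 ->
  (forall j, 0 <= s j) -> (forall j, 0 <= e 1 j) -> 0 <= L -> 0 < del ->
  (forall k x y, W k x - W k y <= L * `|x - y|) ->
  forall k k' x, (k <= k')%N ->
  W k' x <= W k x + L * del + L / (2 * del) * (psum s k' - psum s k)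
              + (L + L / del) * (psum (e 1) k' - psum (e 1) k).
Proof.
move=> Wstep hi1 s0 e0 L0 d0 WL k k' x /subnK <-.
pose b z := Num.sqrt (del ^+ 2 + z ^+ 2).
pose A j := W k x + L / (2 * del) * (psum s j - psum s k)
              + (L + L / del) * (psum (e 1) j - psum (e 1) k).
have claim i y : W (i + k) y <= A (i + k)%N + L * b (y - x).
  elim: i y => [|i IH] y.
    rewrite /A add0n !subrr !mulr0 !addr0.
    have := WL k y x; have : L * `|y - x| <= L * b (y - x).
      by rewrite ler_wpM2l // norm_le_hypot.
    lra.
  have bt := @hypot_tangent del (y - x) _ d0.
  set j := (i + k)%N in IH *; rewrite addSn.
  have b0 : 0 < b (y - x).
    by rewrite sqrtr_gt0 ltr_pwDl ?sqr_ge0 // exprn_gt0.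
  (* The tangent parabola dominates for jumps of any size, so C = 0, and any positive truncation
     level serves; it is taken to be 1. *)
  apply: (le_trans (@Wstep j y (A j + L * b (y - x))
    (L * ((y - x) / b (y - x))) (L / del) 0 1 (lexx _) ltr01 _)).
    move=> h; rewrite mul0r addr0; apply: (le_trans (IH (y + h))).
    have := ler_wpM2l L0 (bt h); rewrite (_ : y + h - x = y - x + h); last ring.
    by rewrite /b /=; lra.
  have zb : `|L * ((y - x) / b (y - x))| <= L.
    rewrite normrM (ger0_norm L0) ler_piMr // normrM normfV (gtr0_norm b0).
    by rewrite ler_pdivrMr // mul1r norm_le_hypot.
  have Ld : 0 <= L / del by rewrite divr_ge0 // ltW.
  rewrite (ger0_norm Ld) Gfun_ge0 // addr0.
  have h1 : s j * (2^-1 * hi * (L / del)) <= L / (2 * del) * s j.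
    rewrite (_ : L / (2 * del) = 2^-1 * (L / del)); last by field; rewrite gt_eqF.
    rewrite mulrC ler_wpM2r // ler_wpM2r //; lra.
  have h2 : (`|L * ((y - x) / b (y - x))| + L / del) * e 1 j <= (L + L / del) * e 1 j.
    by rewrite ler_wpM2r // lerD2r.
  by rewrite /A !psumS; lra.
have := claim (k' - k)%N x.
have -> : b (x - x) = del by rewrite /b subrr expr0n addr0 sqrtr_sqr gtr0_norm.
by rewrite /A; lra.
Qed.

(* Induction over the steps on the inner half of the cylinder; jumps longer
   than [rho / 2] leave it and are charged to the Lindeberg error. *)
Lemma substep_barrier lo hi (K t0 x0 v0 a p q rho : R) : 0 < rho -> 0 <= K ->
  Gfun lo hi q <= a ->
  let P t x := v0 + a * (t - t0) + p * (x - x0) + 2^-1 * q * (x - x0) ^+ 2 in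
  exists2 Q : R, 0 <= Q & forall W s e D k0 k1, substep lo hi W s e ->
    (forall j, 0 <= s j) -> (forall j, 0 <= e (rho ^+ 2 / 8) j) ->
    (forall k x, W k x <= K) -> `|D| <= 1 ->
    (forall k, (k0 <= k <= k1)%N -> `|psum s k - t0| <= 1) ->
    (forall y, `|y - x0| <= rho -> W k0 y <= P (psum s k0) y + D) ->
    (forall k y, (k0 <= k <= k1)%N -> rho / 2 <= `|y - x0| <= rho ->
        W k y <= P (psum s k) y + D) ->
    forall k y, (k0 <= k <= k1)%N -> `|y - x0| <= rho ->
      W k y <= P (psum s k) y + D
               + Q * (psum (e (rho ^+ 2 / 8)) k - psum (e (rho ^+ 2 / 8)) k0).
Proof.
move=> r0 K0 Ga P.
(* [p1] bounds the slope of P on the cylinder and [- A0] bounds the current value A from below. [C]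
   is large enough for the majorant to exceed K after every jump longer than rho / 2. *)
pose p1 := `|p| + `|q| * rho.
pose A0 := `|v0| + `|a| + `|p| * rho + `|q| * rho ^+ 2 + 1.
pose C := 2 * ((K + A0) * (4 / rho ^+ 2) + p1 * (2 / rho) + `|q|).
have r1 := ltW r0.
have p10 : 0 <= p1 by rewrite addr_ge0 // mulr_ge0.
have A00 : 0 <= A0 by rewrite !addr_ge0 // mulr_ge0 // exprn_ge0.
have C0 : 0 <= C.
  apply: mulr_ge0 => //; apply: addr_ge0 => //; apply: addr_ge0.
    by apply: mulr_ge0; [exact: addr_ge0|rewrite divr_ge0 // exprn_ge0].
  by apply: mulr_ge0 => //; exact: divr_ge0.
have Q0 : 0 <= p1 + `|q| + C by apply: addr_ge0 => //; exact: addr_ge0.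
exists (p1 + `|q| + C) => //.
move=> W s e D k0 k1 Wstep s0 e0 WK D1 tk init lat.
set eps := rho ^+ 2 / 8 in e0 *.
have eps0 : 0 < eps by rewrite divr_gt0 // exprn_gt0.
set Q := p1 + `|q| + C in Q0 *.
pose E k := psum (e eps) k - psum (e eps) k0.
have E0 k : (k0 <= k)%N -> 0 <= E k by move=> kk; rewrite subr_ge0 psum_le.
suff claim i y : (k0 + i <= k1)%N -> `|y - x0| <= rho ->
    W (k0 + i)%N y <= P (psum s (k0 + i)) y + D + Q * E (k0 + i)%N.
  by move=> k y /andP[k0k kk1] yr; have := claim (k - k0)%N y; rewrite subnKC //; apply.
elim: i y => [|i IH] y.
  by move=> _ yr; rewrite addn0 /E subrr mulr0 addr0; exact: init.
rewrite addnS => ik1 yr.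
set k := (k0 + i)%N in IH ik1 *.
have k0k : (k0 <= k)%N by rewrite leq_addr.
have kk1 : (k <= k1)%N by exact: ltnW.
(* In the outer annulus the bound is assumed at every step. The scheme is used only from the inner
   half, from which jumps up to rho / 2 stay in the cylinder. *)
case: (lerP (rho / 2) `|y - x0|) => yr2.
  apply: (le_trans (lat k.+1 y _ _)); rewrite ?yr2 ?yr ?(leq_trans k0k) //.
  by rewrite ler_wpDr // mulr_ge0 // E0 // (leq_trans k0k).
have {}IH y' : `|y' - x0| <= rho -> W k y' <= P (psum s k) y' + D + Q * E k.
  by apply: IH.
have Ek : 0 <= E k by exact: E0.
set A := P (psum s k) y + D + Q * E k.
set pp := p + q * (y - x0).
have ppp : `|pp| <= p1.
  apply: (le_trans (ler_normD _ _)); rewrite lerD2l normrM ler_wpM2l //.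
have AA : - A0 <= A.
  have q1 : 0 <= Q * E k by rewrite mulr_ge0.
  have q2 : - `|v0| <= v0 by rewrite lerNl -normrN ler_norm.
  have q3 : - `|a| <= a * (psum s k - t0).
    rewrite lerNl -mulrN; apply: (le_trans (ler_norm _)); rewrite normrM normrN ler_piMr //.
    by apply: tk; rewrite k0k.
  have q4 : - (`|p| * rho) <= p * (y - x0).
    rewrite lerNl -mulrN; apply: (le_trans (ler_norm _)); rewrite normrM normrN ler_wpM2l //.
  have q5 : - (`|q| * rho ^+ 2) <= 2^-1 * q * (y - x0) ^+ 2.
    rewrite lerNl -mulNr -mulrN; apply: (le_trans (ler_norm _)).
    rewrite normrM normrX normrM normrN; apply: ler_pM => //.
      by rewrite normfV ger0_norm // ler_piMl // invf_le1 // ler1n.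
    by rewrite lerXn2r ?nnegrE // ltW.
  have q6 : - 1 <= D by move: D1; rewrite ler_norml => /andP[].
  by rewrite /A /P /A0; lra.
apply: (le_trans (@Wstep k y A pp q C eps C0 eps0 _)).
  move=> h; have PE : P (psum s k) (y + h) + D + Q * E k = A + pp * h + 2^-1 * q * h ^+ 2.
    by rewrite /A /P /pp; field.
  case: (lerP `|h| (rho / 2)) => hr.
    apply: (@le_trans _ _ (P (psum s k) (y + h) + D + Q * E k)).
      apply: IH; rewrite (_ : y + h - x0 = (y - x0) + h); last ring.
      apply: (le_trans (ler_normD _ _)); lra.
    by rewrite PE lerDl mulr_ge0 // le_max lexx orbT.
  (* For a long jump h^2 > rho^2 / 4 = 2 eps, so the excess is at least h^2 / 2; this explains the
     factor 2 in [C]. The terms K + A0 and p1 |h| are themselves bounded by multiples of h^2. *)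
  apply: (le_trans (WK _ _)).
  have h2 : rho ^+ 2 <= 4 * h ^+ 2.
    rewrite -[h ^+ 2]real_normK ?num_real //.
    rewrite (_ : rho ^+ 2 = 4 * (rho / 2) ^+ 2); last by field.
    by rewrite ler_wpM2l // lerXn2r ?nnegrE ?divr_ge0 ?(ltW r0) // ltW.
  have m1 : 2^-1 * h ^+ 2 <= Num.max (h ^+ 2 - eps) 0.
    by rewrite le_max; apply/orP; left; rewrite /eps; lra.
  have m2 : 1 <= 4 / rho ^+ 2 * h ^+ 2.
    by rewrite mulrAC ler_pdivlMr ?mul1r // exprn_gt0.
  have m3 : `|h| <= 2 / rho * h ^+ 2.
    rewrite -[h ^+ 2]real_normK ?num_real // expr2 mulrA ler_peMl //.
    by rewrite mulrAC ler_pdivlMr // mul1r; lra.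
  have m4 : - (p1 * (2 / rho * h ^+ 2)) <= pp * h.
    rewrite lerNl -mulrN; apply: (le_trans (ler_norm _)); rewrite normrM normrN.
    by apply: ler_pM.
  have m5 : - (`|q| * h ^+ 2) <= 2^-1 * q * h ^+ 2.
    rewrite -mulNr ler_wpM2r ?sqr_ge0 //; have := ler_norm (- q); rewrite normrN.
    have := normr_ge0 q; lra.
  have m6 : K + A0 <= (K + A0) * (4 / rho ^+ 2 * h ^+ 2).
    by rewrite ler_peMr // addr_ge0.
  have m7 : C * (2^-1 * h ^+ 2) <= C * Num.max (h ^+ 2 - eps) 0 by rewrite ler_wpM2l.
  have m8 : C * (2^-1 * h ^+ 2) = (K + A0) * (4 / rho ^+ 2 * h ^+ 2)
      + p1 * (2 / rho * h ^+ 2) + `|q| * h ^+ 2.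
    by rewrite /C; field; rewrite gt_eqF.
  lra.
(* The growth of P in time pays for the diffusion term: here G(q) <= a enters. *)
have g1 : s k * Gfun lo hi q <= a * s k by rewrite mulrC ler_wpM2r.
have g2 : (`|pp| + `|q| + C) * e eps k <= Q * e eps k.
  by rewrite ler_wpM2r // !lerD2r.
by rewrite /A /E /P !psumS; lra.
Qed.

End Scheme.

(** * Taylor expansion of test functions *)

Section Taylor.
Context (R : realType).

(** The mean value theorem gives f b - f a = f'(z) (b - a); the two orders of a and b are treated
    separately. *)
Lemma mvt_dist (f : R -> R) (c M a b : R) :
  (forall z, `|z - a| <= `|b - a| -> derivable f z 1 /\ `|derive1 f z - c| <= M) ->
  `|f b - f a - c * (b - a)| <= M * `|b - a|.
Proof.
move=> fP.
have mvt x y : x < y -> (forall z, x <= z <= y -> `|z - a| <= `|b - a|) ->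
    `|f y - f x - c * (y - x)| <= M * (y - x).
  move=> xy zP; have dP z : z \in `[x, y] -> derivable f z 1 /\ `|derive1 f z - c| <= M.
    by rewrite in_itv => /zP /fP.
  have [||z] := @MVT R f (derive1 f) x y xy.
  - move=> z /subset_itv_oo_cc zxy; rewrite derive1E; apply: derivableP.
    by case: (dP z zxy).
  - by apply: derivable_within_continuous => z /dP[].
  move=> /subset_itv_oo_cc /dP[_ zM] ->.
  rewrite -mulrBl normrM (@gtr0_norm _ (y - x)) ?subr_gt0 //.
  by rewrite ler_wpM2r // subr_ge0 ltW.
case: (ltgtP a b) => [ab|ba|<-].
- rewrite (gtr0_norm (_ : 0 < b - a)) ?subr_gt0 //; apply: mvt => // z zab.
  by rewrite !ger0_norm; lra.
- have := mvt _ _ ba; rewrite distrC (@gtr0_norm _ (a - b)) ?subr_gt0 // => H.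
  rewrite (_ : f b - f a - c * (b - a) = - (f a - f b - c * (a - b))); last ring.
  rewrite normrN; apply: H => z zab.
  by rewrite ler0_norm; lra.
- by rewrite !subrr mulr0 subr0 normr0 mulr0.
Qed.

(** The increment is split at (t0, x). The mean value bound applies to psi in time, to [dx psi] at
    time t0, and then to psi at time t0 minus its quadratic term. *)
Lemma C12_taylor (psi : R -> R -> R) (t0 x0 eta : R) :
  C12 psi -> 0 < t0 -> 0 < eta -> exists2 rho, 0 < rho &
    forall t x, `|t - t0| <= rho -> `|x - x0| <= rho ->
    `|psi t x - psi t0 x0 - dt psi t0 x0 * (t - t0) - dx psi t0 x0 * (x - x0)
      - 2^-1 * dxx psi t0 x0 * (x - x0) ^+ 2| <= eta * (`|t - t0| + (x - x0) ^+ 2).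
Proof.
move=> C t00 eta0; have [_ [ct _ cxx]] := C t0 x0 t00.
have /cvgrPdist_le/(_ _ eta0)/nbhs_ballP[r1 /= r10 H1] := ct.
have /cvgrPdist_le/(_ _ eta0)/nbhs_ballP[r2 /= r20 H2] := cxx.
(* The bound t0 / 2 keeps times positive, where [C12] provides derivatives; halving the radii places
   closed neighbourhoods inside the open balls. *)
pose rho := Num.min (t0 / 2) (Num.min (r1 / 2) (r2 / 2)).
have rho0 : 0 < rho by rewrite !lt_min !divr_gt0.
have rt : rho <= t0 / 2 by rewrite ge_min lexx.
have rr1 : rho <= r1 / 2 by rewrite !ge_min lexx !orbT.
have rr2 : rho <= r2 / 2 by rewrite !ge_min lexx !orbT.
exists rho => // t x tr xr.
have h1 : `|psi t x - psi t0 x - dt psi t0 x0 * (t - t0)| <= eta * `|t - t0|.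
  apply: (@mvt_dist (fun z => psi z x)) => z zt.
  have zr := le_trans zt tr.
  have z0 : 0 < z by move: zr; rewrite ler_norml; lra.
  have [[dz _ _] _] := C z x z0; split => //.
  rewrite distrC; apply: (H1 (z, x)).
  by split; rewrite /ball/= distrC; [apply: le_lt_trans zr _|apply: le_lt_trans xr _]; lra.
have h2 z : `|z - x0| <= rho ->
    `|dx psi t0 z - dx psi t0 x0 - dxx psi t0 x0 * (z - x0)| <= eta * `|z - x0|.
  move=> zr; apply: mvt_dist => y yz; have yr := le_trans yz zr.
  have [[_ _ dy] _] := C t0 y t00; split => //.
  rewrite distrC; apply: (H2 (t0, y)).
  split; first exact: ballxx.
  by rewrite /ball/= distrC; apply: le_lt_trans yr _; lra.
pose g z := psi t0 z - 2^-1 * dxx psi t0 x0 * (z - x0) ^+ 2.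
have h3 : `|g x - g x0 - dx psi t0 x0 * (x - x0)| <= eta * `|x - x0| * `|x - x0|.
  apply: mvt_dist => z zx.
  have [[_ dz _] _] := C t0 z t00.
  have dg : is_derive z 1 g (dx psi t0 z - dxx psi t0 x0 * (z - x0)).
    have dz' : is_derive z 1 (psi t0) (dx psi t0 z).
      by rewrite /dx derive1E; exact: derivableP.
    apply: is_derive_eq; rewrite /GRing.scale/= /GRing.scale/=.
    by field.
  have [gd gE] := dg; split => //.
  rewrite derive1E gE.
  have := h2 z (le_trans zx xr).
  rewrite (_ : dx psi t0 z - dx psi t0 x0 - _ =
    dx psi t0 z - dxx psi t0 x0 * (z - x0) - dx psi t0 x0); last ring.
  by move/le_trans; apply; rewrite ler_wpM2l // ltW.
have := ler_normD (psi t x - psi t0 x - dt psi t0 x0 * (t - t0))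
  (g x - g x0 - dx psi t0 x0 * (x - x0)).
rewrite (_ : psi t x - psi t0 x - _ + _ =
    psi t x - psi t0 x0 - dt psi t0 x0 * (t - t0) - dx psi t0 x0 * (x - x0)
      - 2^-1 * dxx psi t0 x0 * (x - x0) ^+ 2); last by rewrite /g; ring.
move/le_trans; apply; rewrite (mulrDr eta); apply: lerD => //.
by rewrite -[_ ^+ 2]real_normK ?num_real // expr2 mulrA.
Qed.

End Taylor.

(** * Limits of schemes along an ultrafilter *)

Section SchemeLimit.
Context (R : realType) (F : set_system nat) (FF : UltraFilter F).

(** Compactness gives a cluster point, and an ultrafilter decides whether the sequence is in a given
    ball, so the cluster point is a limit. All points (t, x) are thereby handled at once, without
    extracting subsequences. *)
Lemma ultra_bounded_cvg (a : nat -> R) (K : R) :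
  (\forall n \near F, `|a n| <= K) -> exists l : R, a n @[n --> F] --> l.
Proof.
move=> aK; have /(_ (a @ F)) := @segment_compact R (- K) K.
case=> [|l [_ cl]].
  by apply: filterS aK => n; rewrite /= in_itv/= ler_norml.
exists l; apply/cvgrPdist_lt => w w0.
have [//|H] := in_ultra_setVsetC [set n | `|l - a n| < w] FF.
have [|z [/= Hz bz]] := cl (~` ball l w) (ball l w) _ (nbhsx_ballx _ _ w0).
  by apply: filterS H => n h; exact: h.
by case: Hz.
Qed.

Variables (s : nat -> nat -> R) (e : nat -> R -> nat -> R).
Hypotheses (s0 : \forall n \near F, forall j, 0 <= s n j)
  (sT : \forall n \near F, forall T : R, exists k, T < psum (s n) k)
  (smesh : forall w : R, 0 < w -> \forall n \near F, forall j, s n j <= w)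
  (e0 : \forall n \near F, forall (eps : R) j, 0 < eps -> 0 <= e n eps j)
  (eT : forall T eps w : R, 0 < eps -> 0 < w -> \forall n \near F,
     forall k, psum (s n) k <= T -> psum (e n eps) k <= w).

(** The step before the first one that passes t ends within one mesh length of t. *)
Lemma grid_near (w : R) : 0 < w -> \forall n \near F, forall t, 0 <= t ->
  exists k, t - w <= psum (s n) k <= t.
Proof.
move=> w0; near=> n => t t0.
have H : exists k, t < psum (s n) k.
  by have : forall T, exists k, T < psum (s n) k by near: n.
case: (ex_minnP H) => -[|k] tk mk; first by move: tk; rewrite psum0 ltNge t0.
have tk' : psum (s n) k <= t by rewrite leNgt; apply/negP => /mk; rewrite ltnn.
have sw : forall j, s n j <= w by near: n; exact: smesh.
exists k; rewrite tk' andbT; move: tk; rewrite psumS; have := sw k; lra.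
Unshelve. all: by end_near. Qed.

(** This is continuous convergence: [del] is fixed before n. Continuity of v and locally uniform
    convergence both follow from it. *)
Definition scheme_limit (W : nat -> nat -> R -> R) (v : R -> R -> R) :=
  forall t x w, 0 <= t -> 0 < w -> exists2 del, 0 < del &
    \forall n \near F, forall k y, `|psum (s n) k - t| <= del -> `|y - x| <= del ->
      `|W n k y - v t x| <= w.

Lemma scheme_limitN W v : scheme_limit W v ->
  scheme_limit (fun n k x => - W n k x) (fun t x => - v t x).
Proof.
move=> H t x w t0 w0; have [del d0 Hd] := H t x w t0 w0; exists del => //.
by apply: filterS Hd => n Hn k y h1 h2; rewrite -opprD normrN; exact: Hn.
Qed.

Section Existence.
Variables (W : nat -> nat -> R -> R) (lo hi K L : R).
Hypotheses (lo1 : lo <= 1) (hi1 : hi <= 1) (L0 : 0 < L)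
  (Wsub : \forall n \near F, substep lo hi (W n) (s n) (e n))
  (Wsup : \forall n \near F, substep hi lo (fun k x => - W n k x) (s n) (e n))
  (WK : \forall n \near F, forall k x, `|W n k x| <= K)
  (WL : \forall n \near F, forall k x y, `|W n k x - W n k y| <= L * `|x - y|).

Lemma scheme_equicontinuous (T w : R) : 0 < w ->
  exists2 del, 0 < del & \forall n \near F, forall k k' x y,
    psum (s n) k <= T -> psum (s n) k' <= T ->
    `|psum (s n) k - psum (s n) k'| <= del -> `|x - y| <= del ->
    `|W n k x - W n k' y| <= w.
Proof.
(* The tolerance w is shared by four terms, each at most w / 4: the barrier height L d, the elapsed
   time, the accumulated error and the shift in space. *)
move=> w0; pose d := w / (4 * L).
have d0 : 0 < d by rewrite divr_gt0 // mulr_gt0.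
pose del := Num.min (w * d / (2 * L)) d.
have del0 : 0 < del by rewrite lt_min d0 andbT divr_gt0 // mulr_gt0.
exists del => //.
have Ld0 : 0 < L + L / d by rewrite addr_gt0 // divr_gt0.
pose w' := w / (4 * (L + L / d)).
have w'0 : 0 < w' by rewrite divr_gt0 // mulr_gt0.
near=> n.
have ns0 : forall j, 0 <= s n j by near: n.
have ne0 : forall j, 0 <= e n 1 j.
  have : forall eps j, 0 < eps -> 0 <= e n eps j by near: n.
  by move=> H j; exact: H.
have neT : forall k, psum (s n) k <= T -> psum (e n 1) k <= w' by near: n; exact: eT.
have nsub : substep lo hi (W n) (s n) (e n) by near: n.
have nsup : substep hi lo (fun k x => - W n k x) (s n) (e n) by near: n.
have nL : forall k x y, `|W n k x - W n k y| <= L * `|x - y| by near: n.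
suff H k k' x y : (k <= k')%N -> psum (s n) k' <= T ->
    psum (s n) k' - psum (s n) k <= del -> `|x - y| <= del ->
    `|W n k' x - W n k y| <= w.
  move=> k k' x y kT k'T kk xy; case: (leqP k' k) => [h|/ltnW h].
    by apply: H => //; exact: le_trans (ler_norm _) kk.
  rewrite distrC; apply: H => //; last by rewrite distrC.
  by apply: le_trans (ler_norm _) _; rewrite distrC.
move=> kk k'T kk' xy.
have h1 := substep_time_le nsub hi1 ns0 ne0 (ltW L0) d0
  (fun k x y => le_trans (ler_norm _) (nL k x y)) x kk.
have NL k0 x0 y0 : - W n k0 x0 - - W n k0 y0 <= L * `|x0 - y0|.
  by rewrite -opprD; apply: le_trans (nL k0 x0 y0); rewrite -normrN ler_norm.
have h2 := substep_time_le nsup lo1 ns0 ne0 (ltW L0) d0 NL x kk.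
have e1 : L * d = w / 4 by rewrite /d; field; rewrite gt_eqF.
have e2 : L / (2 * d) * (psum (s n) k' - psum (s n) k) <= w / 4.
  apply: (@le_trans _ _ (L / (2 * d) * (w * d / (2 * L)))).
    apply: ler_wpM2l.
      by apply: divr_ge0; [exact: ltW|apply: mulr_ge0 => //; exact: ltW].
    by apply: (le_trans kk'); rewrite /del ge_min lexx.
  rewrite le_eqVlt; apply/orP; left; apply/eqP.
  by field; rewrite !gt_eqF.
have e3 : (L + L / d) * (psum (e n 1) k' - psum (e n 1) k) <= w / 4.
  apply: (@le_trans _ _ ((L + L / d) * w')).
    rewrite ler_wpM2l ?(ltW Ld0) //.
    by have := neT k' k'T; have := psum_ge0 k ne0; lra.
  rewrite /w'; move: Ld0; set X := L + L / d => X0.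
  by rewrite le_eqVlt; apply/orP; left; apply/eqP; field; rewrite gt_eqF.
have e4 : `|W n k x - W n k y| <= w / 4.
  apply: (le_trans (nL k x y)); rewrite -e1 ler_wpM2l ?(ltW L0) //.
  by apply: (le_trans xy); rewrite /del ge_min lexx orbT.
by move: e4; rewrite !ler_norml; lra.
Unshelve. all: by end_near. Qed.

(** At each point the limit is taken along grid times approaching t; equicontinuity extends the
    convergence to neighbouring steps and positions. *)
Lemma scheme_limit_exists : exists v, scheme_limit W v.
Proof.
suff H (p : R * R) : exists l, forall w, 0 <= p.1 -> 0 < w -> exists2 del, 0 < del &
    \forall n \near F, forall k y, `|psum (s n) k - p.1| <= del ->
      `|y - p.2| <= del -> `|W n k y - l| <= w.
  have [v vP] := choice H; exists (fun t x => v (t, x)) => t x w.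
  exact: vP (t, x) w.
case: p => t x /=.
case: (lerP 0 t) => t0; last by exists 0.
(* [kap n] is the index of a grid cell containing t; it defaults to 0 when there is none, which does
   not happen for F-almost all n. *)
have /choice[kap kapP] : forall n, exists k,
    (exists k', psum (s n) k' <= t < psum (s n) k'.+1) ->
    psum (s n) k <= t < psum (s n) k.+1.
  move=> n; case: (pselect (exists k', psum (s n) k' <= t < psum (s n) k'.+1)).
    by case=> k ?; exists k.
  by move=> ?; exists 0%N.
have kapN w : 0 < w -> \forall n \near F, `|psum (s n) (kap n) - t| <= w.
  move=> w0; near=> n.
  have H : exists k, t < psum (s n) k.
    by have : forall T, exists k, T < psum (s n) k by near: n.
  have sw : forall j, s n j <= w by near: n; exact: smesh.
  have /kapP : exists k', psum (s n) k' <= t < psum (s n) k'.+1.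
    case: (ex_minnP H) => -[|k] tk mk; first by move: tk; rewrite psum0 ltNge t0.
    exists k; rewrite tk andbT.
    by rewrite leNgt; apply/negP => /mk; rewrite ltnn.
  rewrite psumS ler_norml; have := sw (kap n); lra.
have [l cl] : exists l : R, W n (kap n) x @[n --> F] --> l.
  by apply: (@ultra_bounded_cvg _ K); apply: filterS WK => n; apply.
exists l => w _ w0.
have w20 : 0 < w / 2 by rewrite divr_gt0.
have [del d0 Hd] := scheme_equicontinuous (t + 1) w20.
exists (Num.min (del / 2) 1); first by rewrite lt_min ltr01 andbT divr_gt0.
near=> n => k y; rewrite !le_min => /andP[kd k1] /andP[yd y1].
have h1 : `|psum (s n) (kap n) - t| <= Num.min (del / 2) 1.
  by near: n; apply: kapN; rewrite lt_min ltr01 andbT divr_gt0.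
move: h1; rewrite le_min => /andP[h1 h2].
have h3 : `|l - W n (kap n) x| <= w / 2.
  by near: n; move/cvgrPdist_le : cl; apply.
have HH : forall k k' x y,
    psum (s n) k <= t + 1 -> psum (s n) k' <= t + 1 ->
    `|psum (s n) k - psum (s n) k'| <= del -> `|x - y| <= del ->
    `|W n k x - W n k' y| <= w / 2 by near: n.
have h4 : `|W n k y - W n (kap n) x| <= w / 2.
  apply: HH.
  - by move: k1; rewrite ler_norml; lra.
  - by move: h2; rewrite ler_norml; lra.
  - by move: kd h1; rewrite !ler_norml; lra.
  - by apply: le_trans yd _; lra.
by move: h3 h4; rewrite !ler_norml; lra.
Unshelve. all: by end_near. Qed.

End Existence.

Lemma scheme_limit_le W v (K : R) : scheme_limit W v ->
  (\forall n \near F, forall k x, `|W n k x| <= K) ->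
  forall t x, 0 <= t -> `|v t x| <= K.
Proof.
move=> Wv WK t x t0; apply/ler_addgt0Pr => w w0.
have [del d0 Hd] := Wv t x w t0 w0.
near F => n.
have nK : forall k x, `|W n k x| <= K by near: n.
have : forall t, 0 <= t -> exists k, t - del <= psum (s n) k <= t.
  by near: n; exact: grid_near.
case/(_ t t0) => k kt.
have H : forall k y, `|psum (s n) k - t| <= del -> `|y - x| <= del ->
   `|W n k y - v t x| <= w by near: n.
have := H k x; rewrite subrr normr0 => /(_ _ (ltW d0)) h.
have : `|W n k x - v t x| <= w by apply: h; rewrite ler_norml; lra.
have := nK k x; rewrite !ler_norml; lra.
Unshelve. all: by end_near. Qed.

(** Both values of v are close to the same value of the scheme, taken at x' and at a grid time just
    before t'. *)
Lemma scheme_limit_cont W v : scheme_limit W v ->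
  forall t x w, 0 <= t -> 0 < w -> exists2 del, 0 < del &
    forall t' x', 0 <= t' -> `|t' - t| <= del -> `|x' - x| <= del ->
      `|v t' x' - v t x| <= w.
Proof.
move=> Wv t x w t0 w0; have w20 : 0 < w / 2 by rewrite divr_gt0.
have [del d0 Hd] := Wv t x _ t0 w20.
exists (del / 2); first by rewrite divr_gt0.
move=> t' x' t'0 tt xx.
have [del' d'0 Hd'] := Wv t' x' _ t'0 w20.
near F => n.
have : forall t, 0 <= t -> exists k, t - Num.min (del / 2) del' <= psum (s n) k <= t.
  by near: n; apply: grid_near; rewrite lt_min d'0 divr_gt0.
case/(_ t' t'0) => k /andP[kt kt'].
have {kt}[kt1 kt2] : t' - del / 2 <= psum (s n) k /\ t' - del' <= psum (s n) k.
  by split; apply: le_trans kt; rewrite lerD2l lerN2 ge_min lexx ?orbT.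
have H : forall k y, `|psum (s n) k - t| <= del -> `|y - x| <= del ->
   `|W n k y - v t x| <= w / 2 by near: n.
have H' : forall k y, `|psum (s n) k - t'| <= del' -> `|y - x'| <= del' ->
   `|W n k y - v t' x'| <= w / 2 by near: n.
have h1 : `|W n k x' - v t x| <= w / 2.
  apply: H; last by apply: le_trans xx _; lra.
  by move: tt; rewrite !ler_norml; lra.
have h2 : `|W n k x' - v t' x'| <= w / 2.
  by apply: H'; [rewrite ler_norml; lra|rewrite subrr normr0 ltW].
by move: h1 h2; rewrite !ler_norml; lra.
Unshelve. all: by end_near. Qed.

(** Compactness of the rectangle makes the pointwise neighbourhoods uniform; [P] constrains only
    those points whose time is on the grid of row n. *)
Lemma scheme_limit_uniform W v (T M w : R) : scheme_limit W v -> 0 < w ->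
  \forall n \near F, forall k y, psum (s n) k <= T -> `|y| <= M ->
    `|W n k y - v (psum (s n) k) y| <= w.
Proof.
move=> Wv w0; have w20 : 0 < w / 2 by rewrite divr_gt0.
pose A := `[0, T]%classic `*` `[- M, M]%classic : set (R * R).
have /compact_near_coveringP cA : compact A.
  by apply: compact_setX; exact: segment_compact.
pose P n (p : R * R) := forall k, psum (s n) k = p.1 -> 0 <= p.1 ->
   `|W n k p.2 - v p.1 p.2| <= w.
have BP : \forall n \near F, A `<=` P n.
  apply: cA => -[t x] [/=]; rewrite !in_itv /= => /andP[t0 _] _.
  have [d1 d10 H1] := Wv t x _ t0 w20.
  have [d2 d20 H2] := scheme_limit_cont Wv x t0 w20.
  exists (ball (t, x) (Num.min d1 d2), [set n | forall k y, `|psum (s n) k - t| <= d1 ->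
      `|y - x| <= d1 -> `|W n k y - v t x| <= w / 2]).
    by split => //=; apply: nbhsx_ballx; rewrite lt_min d10.
  move=> [[t' x'] n] /= [[]]; rewrite /ball/= !lt_min.
  move=> /andP[a1 a2] /andP[b1 b2] H k /= kt t'0.
  have h1 : `|W n k x' - v t x| <= w / 2.
    by apply: H; rewrite ?kt distrC ltW.
  have h2 : `|v t' x' - v t x| <= w / 2.
    by apply: H2 => //; rewrite distrC ltW.
  by move: h1 h2; rewrite !ler_norml; lra.
near=> n => k y kT yM.
have ns0 : forall j, 0 <= s n j by near: n.
have k0 := psum_ge0 k ns0.
have AP : A `<=` P n by near: n.
apply: (AP (psum (s n) k, y)) => //.
by split=> /=; rewrite in_itv /= ?k0 // -ler_norml.
Unshelve. all: by end_near. Qed.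

(** If G(q) <= a, the barrier carries the gap between v and the parabola from the bottom and the
    annulus of a cylinder up to (t0, x0), where the two functions agree: a contradiction. Only times
    up to t0 are involved. *)
Lemma scheme_limit_touch W v (lo hi K t0 x0 a p q rho eta : R) :
  scheme_limit W v ->
  (\forall n \near F, substep lo hi (W n) (s n) (e n)) ->
  (\forall n \near F, forall k x, W n k x <= K) -> 0 <= K ->
  0 < rho <= 1 -> rho <= t0 -> 0 < eta <= 1 ->
  (forall t x, t0 - rho <= t <= t0 -> `|x - x0| <= rho ->
     v t x <= v t0 x0 + a * (t - t0) + p * (x - x0) + 2^-1 * q * (x - x0) ^+ 2
              - eta * (t0 - t + (x - x0) ^+ 2)) ->
  a < Gfun lo hi q.
Proof.
move=> Wv Wsub WK K0 /andP[r0 r1] rt /andP[h0 h1] touch.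
rewrite ltNge; apply/negP => Ga.
have [Q Q0 barrier] := substep_barrier t0 x0 (v t0 x0) p r0 K0 Ga.
have t00 : 0 <= t0 by apply: le_trans rt; exact: ltW.
have rr : rho ^+ 2 <= rho by rewrite expr2 ler_piMl // ltW.
have rr0 : 0 < rho ^+ 2 by rewrite exprn_gt0.
(* The strictness term is at least [d] for times up to t0 - rho / 2 (since rho^2 <= rho) and in the
   annulus |x - x0| >= rho / 2. Five errors of size [w] will be incurred, fewer than the eight that
   make up [d]. *)
pose d := eta * rho ^+ 2 / 4; pose w := d / 8.
have d0 : 0 < d by rewrite divr_gt0 // mulr_gt0.
have d1 : d <= 1 / 4.
  by rewrite /d ler_wpM2r // -[1]mulr1; apply: ler_pM => //;
     [exact: ltW|exact: ltW|exact: le_trans r1].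
have w0 : 0 < w by rewrite divr_gt0.
have [del del0 vcont] := scheme_limit_cont Wv x0 t00 w0.
have a10 : 0 < `|a| + 1 by rewrite ltr_wpDl.
have Q10 : 0 < Q + 1 by rewrite ltr_wpDl.
(* Grid tolerance: rho / 4 keeps the bottom and top times ordered and inside the cylinder, w / (|a|
   + 1) controls the drift between the last grid time and t0, and [del] the variation of v there. *)
pose w1 := Num.min (rho / 4) (Num.min (w / (`|a| + 1)) del).
have w10 : 0 < w1.
  by rewrite !lt_min del0 andbT (divr_gt0 r0) //=; exact: divr_gt0.
near F => n.
have ns0 : forall j, 0 <= s n j by near: n.
have ne0 j : 0 <= e n (rho ^+ 2 / 8) j.
  have : forall eps j, 0 < eps -> 0 <= e n eps j by near: n.
  by apply; rewrite divr_gt0.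
have ngrid : forall t, 0 <= t -> exists k, t - w1 <= psum (s n) k <= t.
  by near: n; exact: grid_near.
have nsub : substep lo hi (W n) (s n) (e n) by near: n.
have nK : forall k x, W n k x <= K by near: n.
have nunif : forall k y, psum (s n) k <= t0 -> `|y| <= `|x0| + rho ->
    `|W n k y - v (psum (s n) k) y| <= w.
  by near: n; exact: scheme_limit_uniform.
have nerr : forall k, psum (s n) k <= t0 -> psum (e n (rho ^+ 2 / 8)) k <= w / (Q + 1).
  by near: n; apply: eT; rewrite divr_gt0.
have [k1 /andP[k1a k1b]] := ngrid t0 t00.
have [|k0 /andP[k0a k0b]] := ngrid (t0 - rho / 2).
  by clear -FF s0 sT smesh e0 eT rt r0; lra.
have w1r : w1 <= rho / 4 by rewrite /w1 ge_min lexx.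
have w1a : w1 <= w / (`|a| + 1) by rewrite /w1 !ge_min lexx orbT.
have w1d : w1 <= del by rewrite /w1 !ge_min lexx !orbT.
have k01 : (k0 <= k1)%N.
  by rewrite leqNgt; apply/negP => /ltnW /(psum_le ns0);
     clear -FF s0 sT smesh e0 eT k1a k0b w1r r0; lra.
have kt k : (k0 <= k <= k1)%N -> t0 - rho <= psum (s n) k <= t0.
  move=> /andP[/(psum_le ns0) pa /(psum_le ns0) pb].
  by clear -FF s0 sT smesh e0 eT k0a k1b w1r r0 pa pb; lra.
have Wle k y : (k0 <= k <= k1)%N -> `|y - x0| <= rho ->
    d <= eta * (t0 - psum (s n) k + (y - x0) ^+ 2) ->
    W n k y <= v t0 x0 + a * (psum (s n) k - t0) + p * (y - x0)
      + 2^-1 * q * (y - x0) ^+ 2 + (- d + w).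
  move=> kk yr dle; have := touch _ _ (kt k kk) yr.
  have /andP[_ kt0] := kt k kk.
  have yM : `|y| <= `|x0| + rho.
    by rewrite -[y](subrK x0); apply: (le_trans (ler_normD _ _)); rewrite addrC lerD2l.
  have := nunif k y kt0 yM; rewrite ler_norml; clear -FF s0 sT smesh e0 eT dle; lra.
have x00 : `|x0 - x0| <= rho by rewrite subrr normr0 ltW.
have := barrier (W n) (s n) (e n) (- d + w) k0 k1 nsub ns0 ne0 nK.
have -> : `|- d + w| <= 1 by rewrite ler_norml /w; clear -FF s0 sT smesh e0 eT d0 d1; lra.
move=> /(_ isT) bar.
have {bar} := bar _ _ _ k1 x0 _ x00; rewrite k01 leqnn => /(_ _ _ _ isT) bar.
have : W n k1 x0 <= v t0 x0 + a * (psum (s n) k1 - t0) + p * (x0 - x0)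
    + 2^-1 * q * (x0 - x0) ^+ 2 + (- d + w)
    + Q * (psum (e n (rho ^+ 2 / 8)) k1 - psum (e n (rho ^+ 2 / 8)) k0).
  apply: bar.
  - by move=> k /kt kk; rewrite ler_norml; clear -FF s0 sT smesh e0 eT kk r1; lra.
  - move=> y yr; apply: Wle => //; first by rewrite leqnn.
    rewrite /d -mulrA ler_wpM2l ?(ltW h0) //; have := sqr_ge0 (y - x0).
    by clear -FF s0 sT smesh e0 eT rr k0b r0; lra.
  - move=> k y kk /andP[ya yr]; apply: Wle => //.
    rewrite /d -mulrA ler_wpM2l ?(ltW h0) //.
    have : (rho / 2) ^+ 2 <= (y - x0) ^+ 2.
      rewrite -[leRHS]real_normK ?num_real // lerXn2r ?nnegrE //;
        clear -FF s0 sT smesh e0 eT r0; lra.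
    by have /andP[_] := kt k kk; clear -FF s0 sT smesh e0 eT; lra.
rewrite subrr expr0n !mulr0 !addr0.
have e1 : a * (psum (s n) k1 - t0) <= w.
  apply: (le_trans (ler_norm _)); rewrite normrM.
  apply: (@le_trans _ _ ((`|a| + 1) * (w / (`|a| + 1)))).
    apply: ler_pM => //; first by rewrite lerDl.
    by rewrite ler_norml; clear -FF s0 sT smesh e0 eT k1a k1b w1a w10; lra.
  by rewrite mulrC divfK // gt_eqF.
have e2 : Q * (psum (e n (rho ^+ 2 / 8)) k1 - psum (e n (rho ^+ 2 / 8)) k0) <= w.
  apply: (@le_trans _ _ ((Q + 1) * (w / (Q + 1)))); last by rewrite mulrC divfK // gt_eqF.
  apply: (@le_trans _ _ (Q * (w / (Q + 1)))).
    apply: ler_wpM2l => //; have := nerr k1 k1b; have := psum_ge0 k0 ne0.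
    by clear; lra.
  by apply: ler_wpM2r; [rewrite divr_ge0 // ltW|rewrite lerDl].
have e3 : `|v (psum (s n) k1) x0 - v t0 x0| <= w.
  apply: vcont; first exact: psum_ge0.
    by rewrite ler_norml; clear -FF s0 sT smesh e0 eT k1a k1b w1d w10; lra.
  by rewrite subrr normr0 ltW.
have e4 : `|W n k1 x0 - v (psum (s n) k1) x0| <= w.
  by apply: nunif => //; rewrite lerDl ltW.
have : d = 8 * w by rewrite /w; field.
by move: e3 e4; rewrite !ler_norml; clear -FF s0 sT smesh e0 eT e1 e2 w0; lra.
Unshelve. all: by end_near. Qed.

(** Tilting the parabola to time slope a - 2 eta and curvature q + 4 eta turns contact up to an
    eta-error into strict contact at times before t0. *)
Lemma scheme_limit_jet W v (lo hi K t0 x0 a p q : R) :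
  scheme_limit W v ->
  (\forall n \near F, substep lo hi (W n) (s n) (e n)) ->
  (\forall n \near F, forall k x, `|W n k x| <= K) ->
  0 <= lo <= 1 -> 0 <= hi <= 1 -> 0 < t0 ->
  (forall eta, 0 < eta -> exists2 rho, 0 < rho &
    forall t x, `|t - t0| <= rho -> `|x - x0| <= rho ->
      v t x <= v t0 x0 + a * (t - t0) + p * (x - x0) + 2^-1 * q * (x - x0) ^+ 2
               + eta * (`|t - t0| + (x - x0) ^+ 2)) ->
  a <= Gfun lo hi q.
Proof.
move=> Wv Wsub WK lo01 hi01 t00 jet; rewrite leNgt; apply/negP => Ga.
(* Strict contact gives a - 2 eta < G(q + 4 eta) <= G(q) + 4 eta, that is a - G(q) < 6 eta, which
   this choice contradicts. *)
pose eta := Num.min 1 ((a - Gfun lo hi q) / 6).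
have eta0 : 0 < eta by rewrite lt_min ltr01 divr_gt0 // subr_gt0.
have eta1 : eta <= 1 by rewrite ge_min lexx.
have eta2 : eta <= (a - Gfun lo hi q) / 6 by rewrite ge_min lexx orbT.
have [rho' rho'0 H] := jet eta eta0.
pose rho := Num.min rho' (Num.min 1 t0).
have rho0 : 0 < rho by rewrite !lt_min rho'0 ltr01.
have r1 : rho <= rho' by rewrite ge_min lexx.
have r2 : rho <= 1 by rewrite !ge_min lexx !orbT.
have r3 : rho <= t0 by rewrite !ge_min lexx !orbT.
have WK' : \forall n \near F, forall k x, W n k x <= `|K|.
  apply: filterS WK => n h k x; apply: le_trans (ler_norm _) _.
  exact: le_trans (h k x) (ler_norm _).
suff : a - 2 * eta < Gfun lo hi (q + 4 * eta).
  have := @GfunD_le R lo hi q (4 * eta) lo01 hi01; rewrite mulr_ge0 ?(ltW eta0) //.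
  by move=> /(_ isT); lra.
apply: (@scheme_limit_touch W v lo hi `|K| t0 x0
  (a - 2 * eta) p (q + 4 * eta) rho eta) => //; rewrite ?rho0 ?eta0 //.
move=> t x /andP[ta tb] xr.
have := H t x _ (le_trans xr r1); rewrite ler0_norm; last by rewrite subr_le0.
by move=> /(_ _)/le_trans; apply; lra.
Qed.

(** At a local maximum of v - psi, the Taylor expansion of psi bounds v as in the jet lemma. *)
Lemma scheme_limit_visc_sub W v (lo hi K : R) :
  scheme_limit W v ->
  (\forall n \near F, substep lo hi (W n) (s n) (e n)) ->
  (\forall n \near F, forall k x, `|W n k x| <= K) ->
  0 <= lo <= 1 -> 0 <= hi <= 1 -> visc_subsolution (Gfun lo hi) v.
Proof.
move=> Wv Wsub WK lo01 hi01 psi C t0 x0 t00 /nbhs_ballP[r /= r0 loc].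
rewrite subr_le0; apply: (scheme_limit_jet (p := dx psi t0 x0) (t0 := t0) (x0 := x0)
  Wv Wsub WK) => // eta eta0.
have [rho rho0 H] := C12_taylor x0 C t00 eta0.
exists (Num.min rho (r / 2)); first by rewrite lt_min rho0 divr_gt0.
move=> t x; rewrite !le_min => /andP[t1 t2] /andP[x1 x2].
have bx : ball (t0, x0) r (t, x).
  by split; rewrite /ball/= distrC; [apply: le_lt_trans t2 _|apply: le_lt_trans x2 _]; lra.
have /= := loc _ bx.
by have := H t x t1 x1; rewrite ler_norml; lra.
Qed.

(** The jet lemma is applied to -v and -W, with the variances exchanged. *)
Lemma scheme_limit_visc_super W v (lo hi K : R) :
  scheme_limit W v ->
  (\forall n \near F, substep hi lo (fun k x => - W n k x) (s n) (e n)) ->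
  (\forall n \near F, forall k x, `|W n k x| <= K) ->
  0 <= lo <= 1 -> 0 <= hi <= 1 -> visc_supersolution (Gfun lo hi) v.
Proof.
move=> Wv Wsub WK lo01 hi01 psi C t0 x0 t00 /nbhs_ballP[r /= r0 loc].
have WKN : \forall n \near F, forall k x, `|- W n k x| <= K.
  by apply: filterS WK => n h k x; rewrite normrN.
rewrite subr_ge0 -lerN2 -GfunN.
apply: (scheme_limit_jet (p := - dx psi t0 x0) (t0 := t0) (x0 := x0)
  (scheme_limitN Wv) Wsub WKN) => // eta eta0.
have [rho rho0 H] := C12_taylor x0 C t00 eta0.
exists (Num.min rho (r / 2)); first by rewrite lt_min rho0 divr_gt0.
move=> t x; rewrite !le_min => /andP[t1 t2] /andP[x1 x2].
have bx : ball (t0, x0) r (t, x).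
  by split; rewrite /ball/= distrC; [apply: le_lt_trans t2 _|apply: le_lt_trans x2 _]; lra.
have /= := loc _ bx.
by have := H t x t1 x1; rewrite ler_norml; lra.
Qed.

(** Time 1 is reached at step [N n]. The limit v is bounded, hence of polynomial growth, so
    uniqueness identifies it with u. *)
Lemma scheme_cvg W (lo hi K L : R) phi u (N : nat -> nat) :
  0 <= lo <= 1 -> 0 <= hi <= 1 -> 0 < L ->
  (\forall n \near F, substep lo hi (W n) (s n) (e n)) ->
  (\forall n \near F, substep hi lo (fun k x => - W n k x) (s n) (e n)) ->
  (\forall n \near F, forall k x, `|W n k x| <= K) ->
  (\forall n \near F, forall k x y, `|W n k x - W n k y| <= L * `|x - y|) ->
  (\forall n \near F, forall x, W n 0%N x = phi x) ->
  (\forall n \near F, psum (s n) (N n) = 1) ->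
  unique_visc_solution (Gfun lo hi) phi u ->
  W n (N n) 0 @[n --> F] --> u 1 0.
Proof.
move=> lo01 hi01 L0 Wsub Wsup WK WL W0 sN [_ _ uniq].
have [lo1 hi1] : lo <= 1 /\ hi <= 1 by case/andP: lo01; case/andP: hi01.
have [v Wv] := scheme_limit_exists lo1 hi1 L0 Wsub Wsup WK WL.
have K0 : 0 <= K.
  near F => n; have nK : forall k x, `|W n k x| <= K by near: n.
  exact: le_trans (normr_ge0 _) (nK 0%N 0).
have vphi x : v 0 x = phi x.
  apply/eqP; rewrite -subr_eq0 -normr_le0; apply/ler_addgt0Pr => w w0; rewrite add0r.
  have [del d0 H] := Wv 0 x w (lexx _) w0.
  near F => n.
  have nH : forall k y, `|psum (s n) k - 0| <= del -> `|y - x| <= del ->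
      `|W n k y - v 0 x| <= w by near: n.
  have nW0 : forall x, W n 0%N x = phi x by near: n.
  rewrite distrC -nW0; apply: nH; last by rewrite subrr normr0 ltW.
  by rewrite psum0 subrr normr0 ltW.
have vu : v 1 0 = u 1 0.
  apply: uniq => //; last first.
    move=> T T0; exists K, 0%N => t x /andP[t0 _]; rewrite expr0.
    have := scheme_limit_le Wv WK x t0; lra.
  split => //.
  - apply/subspace_continuousP => -[t x] /= t0; apply/cvgrPdist_le => w w0.
    have [del d0 H] := scheme_limit_cont Wv x t0 w0.
    apply/nbhs_ballP; exists del => //=.
    move=> [t' x'] [/= b1 b2] t'0; rewrite distrC; apply: H => //.
      by rewrite distrC ltW.
    by rewrite distrC ltW.
  - exact: (scheme_limit_visc_sub Wv Wsub WK).
  - exact: (scheme_limit_visc_super Wv Wsup WK).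
rewrite -vu; apply/cvgrPdist_le => w w0.
have [del d0 H] := Wv 1 0 w ler01 w0.
near=> n.
have nH : forall k y, `|psum (s n) k - 1| <= del -> `|y - 0| <= del ->
    `|W n k y - v 1 0| <= w by near: n.
have nN : psum (s n) (N n) = 1 by near: n.
by rewrite distrC; apply: nH; rewrite ?nN subrr normr0 ltW.
Unshelve. all: by end_near. Qed.

End SchemeLimit.

(** * The array as a scheme *)

(** If convergence fails, the indices of distant terms meet every neighbourhood of infinity; an
    ultrafilter containing them and refining \oo contradicts the hypothesis. *)
Lemma cvg_ultra (R : realType) (a : nat -> R) (l : R) :
  (forall F, UltraFilter F -> \oo `<=` F -> a n @[n --> F] --> l) ->
  a n @[n --> \oo] --> l.
Proof.
move=> H; apply/cvgrPdist_lt => w w0; apply: contrapT => nA.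
pose A := [set n | `|l - a n| < w].
have PF : ProperFilter (within (~` A) \oo).
  apply: Build_ProperFilter; rewrite /within/= => H0; apply: nA.
  by apply: filterS H0 => n /= nn; apply: contrapT => /nn.
have [G [UG FG]] := ultraFilterLemma PF.
have /cvgrPdist_lt/(_ w w0) GA : a n @[n --> G] --> l.
  by apply: H => P PP; apply: FG; rewrite /within/=; apply: filterS PP.
have GnA : G (~` A) by apply: FG; rewrite /within/=; exact: nearW.
have : G (A `&` ~` A) by apply: filterI => //; exact: GA.
by rewrite setICr; exact: (@filter_not_empty _ G (@ultra_proper _ _ UG)).
Qed.

Section Cyclic.
Context (T : Type).

(* [cyc g d] runs through [g] backwards, periodically; [d] is only reached
   when [N = 0]. *)
Definition cyc (N : nat) (g : 'I_N -> T) (d : T) (j : nat) : T :=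
  oapp (fun i => g (rev_ord i)) d (insub (j %% N)%N).

Lemma cycP (N : nat) (g : 'I_N -> T) (d : T) (j : nat) (P : T -> Prop) :
  P d -> (forall i, P (g i)) -> P (cyc g d j).
Proof. by move=> Pd Pg; rewrite /cyc; case: insub => [i|] /=. Qed.

Lemma cyc_rev (N : nat) (g : 'I_N -> T) (d : T) (i : 'I_N) :
  cyc g d (rev_ord i) = g i.
Proof.
rewrite /cyc modn_small ?ltn_ord // insubT ?ltn_ord // => lt /=.
by congr g; rewrite -[RHS]rev_ordK; congr rev_ord; exact: val_inj.
Qed.

End Cyclic.

Lemma cyc_map (T U : Type) (f : T -> U) N (g : 'I_N -> T) d j :
  f (cyc g d j) = cyc (fun i => f (g i)) (f d) j.
Proof. by rewrite /cyc; case: insub. Qed.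

(** Each block of N indices is one full period, and reading it backwards does not change its sum. *)
Lemma psum_cyc (R : realType) N (g : 'I_N -> R) p :
  psum (cyc g 0) (p * N)%N = p%:R * \sum_(i < N) g i.
Proof.
elim: p => [|p IH]; first by rewrite mul0n psum0 mul0r.
rewrite mulSn addnC /psum -(big_mkord xpredT) /= (@big_cat_nat _ _ _ (p * N)) ?leq_addr //=.
rewrite big_mkord -/(psum _ _) IH -[X in _ + X]/(_) -natr1 mulrDl mul1r; congr (_ + _).
rewrite -{1}[(p * N)%N]add0n big_addn addKn big_mkord (reindex_inj rev_ord_inj) /=.
apply: eq_bigr => i _; rewrite -(cyc_rev g 0 i) /cyc.
by rewrite addnC modnMDl.
Qed.

(** * The backward recursion as a monotone scheme *)

Section Iteration.
Context (R : realType) (d : measure_display) (Omega : measurableType d).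
Variable S : sublinear_expectation R Omega.
Variables (h : nat -> Omega -> R) (phi : R -> R) (r K L : R).
Hypotheses (rh : forall j, rv S (h j)) (fh : forall j, finrv S (fun w => h j w ^+ 2))
  (phiK : forall x, `|phi x| <= K)
  (phiL : forall x y, `|phi x - phi y| <= L * `|x - y|).

(** y is the sum so far and k counts the variables still to be added. [h 0] is added last, so h
    lists a row from its end. *)
Fixpoint backward (k : nat) (y : R) : R :=
  if k is k'.+1 then ee S (fun w => backward k' (y + h k' w)) else phi y.

Definition step_length j := ee S (fun w => h j w ^+ 2).
(** The share of one step in the three sums assumed to vanish: means, variance gap, Lindeberg
    excess. *)
Definition step_error eps j := `|ee S (h j)| + `|ee S (fun w => - h j w)|
  + `|r * step_length j + ee S (fun w => - (h j w ^+ 2))|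
  + ee S (fun w => Num.max (h j w ^+ 2 - eps) 0).

(** Monotonicity and translation by constants let both bounds pass through the expectation
    unchanged. *)
Lemma backward_bounded_lip k :
  (forall x, `|backward k x| <= K) /\
  (forall x y, `|backward k x - backward k y| <= L * `|x - y|).
Proof.
elim: k => [//|k [IK IL]] /=.
have fin y : finrv S (fun w => backward k (y + h k w)).
  apply: (@finrv_bounded _ _ _ S (fun z => backward k (y + z)) (h k) K) => //.
  apply: (@lip_C_lLip _ _ _ L) => a b; apply: (le_trans (IL _ _)).
  by rewrite opprD addrACA subrr add0r.
split=> [x|x y].
  rewrite ler_norml; apply/andP; split.
    rewrite -[leLHS](ee_cst S); apply: ee_le => // [|w]; first exact: finrv_cst.
    by have := IK (x + h k w); rewrite ler_norml => /andP[].
  rewrite -[leRHS](ee_cst S); apply: ee_le => // [|w]; first exact: finrv_cst.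
  by have := IK (x + h k w); rewrite ler_norml => /andP[].
have le x0 y0 : ee S (fun w => backward k (x0 + h k w)) <=
    ee S (fun w => backward k (y0 + h k w)) + L * `|x0 - y0|.
  rewrite -eeDc //; apply: ee_le => // [|w].
    by apply: finrvD => //; exact: finrv_cst.
  have := IL (x0 + h k w) (y0 + h k w).
  by rewrite opprD addrACA subrr addr0 ler_norml; lra.
have := le x y; have := le y x; rewrite (distrC y x) ler_norml; lra.
Qed.

Lemma finrv_backward k y X : rv S X -> finrv S (fun w => backward k (y + X w)).
Proof.
move=> rX; have [IK IL] := backward_bounded_lip k.
apply: (@finrv_bounded _ _ _ S (fun z => backward k (y + z)) X K) => //.
apply: (@lip_C_lLip _ _ _ L) => a b; apply: (le_trans (IL _ _)).
by rewrite opprD addrACA subrr add0r.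
Qed.

Lemma step_length_ge0 j : 0 <= step_length j.
Proof.
rewrite -[leLHS](ee_cst S); apply: ee_le => // [|w]; [exact: finrv_cst|exact: sqr_ge0].
Qed.

Lemma step_excess_ge0 eps j : 0 < eps -> 0 <= ee S (fun w => Num.max (h j w ^+ 2 - eps) 0).
Proof.
move=> eps0; rewrite -[leLHS](ee_cst S); apply: ee_le; first exact: finrv_cst.
  exact: (finrv_sqr_excess (rh j) (fh j) eps0).
by move=> w; rewrite le_max lexx orbT.
Qed.

Lemma step_error_ge0 eps j : 0 < eps -> 0 <= step_error eps j.
Proof. by move=> eps0; rewrite !addr_ge0 // step_excess_ge0. Qed.

Let error_le eps j (p q C : R) : 0 <= C -> 0 < eps ->
  `|p| * (`|ee S (h j)| + `|ee S (fun w => - h j w)|)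
  + `|q| * `|r * step_length j + ee S (fun w => - (h j w ^+ 2))|
  + C * ee S (fun w => Num.max (h j w ^+ 2 - eps) 0)
  <= (`|p| + `|q| + C) * step_error eps j.
Proof.
move=> C0 eps0; have l0 := step_excess_ge0 j eps0; rewrite /step_error.
set m := _ + `|ee S (fun w => - h j w)|; set v := `|r * _ + _|; set l := ee S _ in l0 *.
have m0 : 0 <= m by rewrite addr_ge0.
have v0 : 0 <= v by exact: normr_ge0.
have := mulr_ge0 (normr_ge0 p) v0; have := mulr_ge0 (normr_ge0 p) l0.
have := mulr_ge0 (normr_ge0 q) m0; have := mulr_ge0 (normr_ge0 q) l0.
have := mulr_ge0 C0 v0; have := mulr_ge0 C0 m0; lra.
Qed.

Lemma backward_substep : substep r 1 backward step_length step_error.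
Proof.
move=> k y A p q C eps C0 eps0 H /=.
have := error_le k p q C0 eps0.
have := @one_step_le _ _ _ S (h k) r (`|ee S (h k)| + `|ee S (fun w => - h k w)|)
  (`|r * step_length k + ee S (fun w => - (h k w ^+ 2))|)
  (ee S (fun w => Num.max (h k w ^+ 2 - eps) 0)) eps (rh k) (fh k) eps0.
rewrite lerDl normr_ge0 lerDr normr_ge0 lexx => /(_ isT isT isT (lexx _)).
move=> /(_ _ A p q C (finrv_backward k y (rh k)) C0 (fun w => H (h k w))).
rewrite -/(step_length k); lra.
Qed.

Lemma backwardN_substep :
  substep 1 r (fun k x => - backward k x) step_length step_error.
Proof.
move=> k y A p q C eps C0 eps0 H /=.
have := error_le k p q C0 eps0.
have := @one_step_ge _ _ _ S (h k) r (`|ee S (h k)| + `|ee S (fun w => - h k w)|)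
  (`|r * step_length k + ee S (fun w => - (h k w ^+ 2))|)
  (ee S (fun w => Num.max (h k w ^+ 2 - eps) 0)) eps (rh k) (fh k) eps0.
rewrite lerDl normr_ge0 lerDr normr_ge0 lexx => /(_ isT isT isT (lexx _)).
move=> /(_ _ A p q C (finrv_backward k y (rh k)) C0 (fun w => H (h k w))).
rewrite -/(step_length k); lra.
Qed.

(** From h^2 <= eps + (h^2 - eps)^+; under the Lindeberg condition this makes the mesh of the time
    grid tend to 0. *)
Lemma step_length_le eps j : 0 < eps ->
  step_length j <= eps + ee S (fun w => Num.max (h j w ^+ 2 - eps) 0).
Proof.
move=> eps0; have fp := finrv_sqr_excess (rh j) (fh j) eps0.
rewrite addrC -eeDc //; apply: ee_le => // [|w].
  by apply: finrvD => //; exact: finrv_cst.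
by rewrite -lerBlDr le_max lexx.
Qed.

End Iteration.

(** * Unrolling the expectation of a row by independence *)

Section RowIndependence.
Context (R : realType) (d : measure_display) (Omega : measurableType d).
Variable S : sublinear_expectation R Omega.
Variables (N : nat) (X : 'I_N -> Omega -> R) (b : R) (phi : R -> R) (K L : R).
Hypotheses (indX : independent_rvs S X) (b0 : 0 < b) (L0 : 0 <= L)
  (phiK : forall x, `|phi x| <= K)
  (phiL : forall x y, `|phi x - phi y| <= L * `|x - y|).

Definition scaled_row : nat -> Omega -> R :=
  cyc (fun i w => X i w / b) (fun=> 0).

Lemma rv_div (Y : Omega -> R) : rv S Y -> rv S (fun w => Y w / b).
Proof.
move=> rY; rewrite (_ : (fun w => _) = (fun w => b^-1 * Y w)); first exact: rv_scale.
by apply/funext => w; rewrite mulrC.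
Qed.

Let partial k w := (\sum_(i < N | (i < k)%N) X i w) / b.

Lemma rv_sum (I : Type) (s : seq I) (P : pred I) (Y : I -> Omega -> R) :
  (forall i, rv S (Y i)) -> rv S (fun w => \sum_(i <- s | P i) Y i w).
Proof.
move=> rY; elim: s => [|i s IH].
  rewrite (_ : (fun w => _) = (fun=> 0)); first exact: rv_zero.
  by apply/funext => w; rewrite big_nil.
case: (boolP (P i)) => Pi.
  rewrite (_ : (fun w => _) = (fun w => Y i w + \sum_(i <- s | P i) Y i w)).
    exact: rv_add.
  by apply/funext => w; rewrite big_cons Pi.
by under eq_fun do rewrite big_cons (negbTE Pi).
Qed.

Lemma rv_scaled_row j : rv S (scaled_row j).
Proof. by apply: cycP; [exact: rv_zero|move=> i; apply: rv_div; case: indX]. Qed.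

Let rv_partial k : rv S (partial k).
Proof. by apply: rv_div; apply: rv_sum => i; case: indX. Qed.

Let fin_back j Y : rv S Y -> finrv S (fun w => backward S scaled_row phi j (Y w)).
Proof.
move=> rY; rewrite (_ : (fun w => _) = (fun w => backward S scaled_row phi j (0 + Y w))).
  exact: (finrv_backward rv_scaled_row phiK phiL).
by apply/funext => w; rewrite add0r.
Qed.

(** Independence of [X k] from its predecessors integrates it out, which is one step of the
    recursion. *)
Let backward_step (k : 'I_N) :
  ee S (fun w => backward S scaled_row phi (N - k.+1) (partial k.+1 w)) =
  ee S (fun w => backward S scaled_row phi (N - k) (partial k w)).
Proof.
rewrite -(subnSK (ltn_ord k)) /=.
set j := (N - k.+1)%N; set g := backward S scaled_row phi j.
(* The reversal in [cyc] places variable k at position N - k - 1, the one consumed by this step. *)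
have hE : scaled_row j = (fun w => X k w / b).
  exact: (cyc_rev (fun i w => X i w / b) (fun=> 0) k).
have pS w : partial k.+1 w = partial k w + X k w / b.
  rewrite /partial -mulrDl (bigD1 k) //= addrC; congr ((_ + _) / b).
  by apply: eq_bigl => i; rewrite ltnS ltn_neqAle andbC.
have [gK gL] := backward_bounded_lip rv_scaled_row phiK phiL j.
have rXk : rv S (fun w => X k w / b) by apply: rv_div; case: indX.
have fg c : finrv S (fun w => g (c + X k w / b)).
  exact: (finrv_backward rv_scaled_row phiK phiL).
have gE c : ee S (fun w => g (c + X k w / b)) =
    backward S scaled_row phi j.+1 c by rewrite /= hE.
under eq_fun do rewrite pS.
(* Independence speaks of k > 0. For the first variable the partial sum is the constant 0. *)
have [k0|k0] := posnP k.
  have P0 w : partial k w = 0.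
    by rewrite /partial big_pred0 ?mul0r // => i; rewrite k0.
  rewrite hE; under eq_fun do rewrite P0; under [in RHS]eq_fun do rewrite P0.
  by rewrite ee_cst.
pose wk := widen_ord (ltnW (ltn_ord k)).
have PE w : partial k w = (\sum_(i < k) X (wk i) w) / b.
  by rewrite /partial (big_ord_narrow (ltnW (ltn_ord k))).
(* The test function for independence: it is Lipschitz for the maximum norm with constant L (k + 1)
   / b. *)
pose f (z : 'rV[R]_(k + 1)) := g ((\sum_i z 0 i) / b).
have fE (x : 'rV[R]_k) w : f (row_mx x (rvec (fun=> X k) w)) =
    g ((\sum_i x 0 i) / b + X k w / b).
  rewrite /f -mulrDl big_split_ord big_ord1 /= row_mxEr mxE.
  by congr (g ((_ + _) / b)); apply: eq_bigr => i _; rewrite row_mxEl.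
have lipf : C_lLip f.
  apply: (@lip_C_lLip _ _ _ (L * ((k + 1)%:R / b))) => x y.
  apply: (le_trans (gL _ _)); rewrite -mulrA ler_wpM2l //.
  rewrite -mulrBl -sumrB normrM normfV (gtr0_norm b0) mulrAC.
  rewrite ler_wpM2r ?invr_ge0 ?(ltW b0) //.
  apply: (le_trans (ler_norm_sum _ _ _)).
  apply: (@le_trans _ _ (\sum_(i < k + 1) `|x - y|)).
    by apply: ler_sum => i _; have := coord_le_norm (x - y) i; rewrite !mxE.
  by rewrite sumr_const card_ord mulr_natl.
have fbarE (x : 'rV[R]_k) : expect S (fun w => `|f (row_mx x (rvec (fun=> X k) w))|%R) =
    (ee S (fun w => `|g ((\sum_i x 0 i) / b + X k w / b)|))%:E.
  rewrite -expect_fin; last exact: finrv_abs.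
  by congr expect; apply/funext => w; rewrite fE.
have normg c : 0 <= ee S (fun w => `|g (c + X k w / b)|) <= K.
  apply/andP; split.
    rewrite -[leLHS](ee_cst S); apply: ee_le => // [|]; first exact: finrv_cst.
    exact: finrv_abs.
  rewrite -[leRHS](ee_cst S); apply: ee_le => // [|]; first exact: finrv_abs.
  exact: finrv_cst.
have Xfin (x : 'rV[R]_k) :
    (expect S (fun w => `|f (row_mx x (rvec (fun=> X k) w))|%R) < +oo)%E.
  by rewrite fbarE ltry.
(* The variable lies between the constants 0 and K, which bounds its expectation without deciding
   whether it is in H. *)
have Xfin2 : (expect S (fun w => `|fine (expect S (fun w' =>
    `|f (row_mx (rvec (fun i => X (wk i)) w) (rvec (fun=> X k) w'))|%R))|%R) < +oo)%E.
  have H w : (fun=> 0) w <= `|fine (expect S (fun w' =>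
      `|f (row_mx (rvec (fun i => X (wk i)) w) (rvec (fun=> X k) w'))|%R))| <= (fun=> K) w.
    rewrite normr_ge0 fbarE /=.
    have /andP[h1 h2] := normg ((\sum_i rvec (fun i => X (wk i)) w 0 i) / b).
    by rewrite ger0_norm.
  have /andP[_ H2] := expect_sandwich (finrv_cst S 0) (finrv_cst S K) H.
  by apply: le_lt_trans H2 _; rewrite ltry.
have := indX.2 k k0 f lipf Xfin Xfin2.
have sumE w : (\sum_i rvec (fun i => X (wk i)) w 0 i) / b = partial k w.
  by rewrite PE; congr (_ / _); apply: eq_bigr => i _; rewrite mxE.
rewrite (_ : (fun w => f _) = (fun w => g (partial k w + X k w / b))); last first.
  by apply/funext => w; rewrite fE sumE.
rewrite [in RHS](_ : (fun w => fine _) =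
    (fun w => backward S scaled_row phi j.+1 (partial k w))); last first.
  apply/funext => w; rewrite -gE -[RHS]/(fine (_)%:E) -expect_fin //.
  by congr (fine (expect S _)); apply/funext => w'; rewrite fE sumE.
rewrite !expect_fin; [by case|exact: fin_back|].
rewrite (_ : (fun w => _) = (fun w => g (partial k.+1 w))); first exact: fin_back.
by apply/funext => w; rewrite pS.
Qed.

(** The steps chain from k = N, the full sum under phi, down to k = 0, where the integrand is
    constant. *)
Lemma expect_row : expect S (fun w => phi ((\sum_(k < N) X k w) / b)) =
  (backward S scaled_row phi N 0)%:E.
Proof.
have E0N : (fun w => phi ((\sum_(k < N) X k w) / b)) =
    (fun w => backward S scaled_row phi (N - N) (partial N w)).
  apply/funext => w; rewrite subnn /partial /=; congr (phi (_ / _)).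
  by apply: eq_bigl => i; rewrite ltn_ord.
rewrite E0N expect_fin; last exact: fin_back.
have claim k : (k <= N)%N ->
    ee S (fun w => backward S scaled_row phi (N - k) (partial k w)) =
    ee S (fun w => backward S scaled_row phi (N - 0) (partial 0 w)).
  elim: k => // k IH kN; rewrite -IH; last exact: ltnW.
  exact: (backward_step (Ordinal kN)).
rewrite claim // subn0 (_ : (fun w => _) = (fun=> backward S scaled_row phi N 0)) ?ee_cst //.
by apply/funext => w; rewrite /partial big_pred0 ?mul0r.
Qed.

End RowIndependence.

(** * Moments of the normalised row *)

Section RowMoments.
Context (R : realType) (d : measure_display) (Omega : measurableType d).
Variable S : sublinear_expectation R Omega.

Lemma ee_div (Y : Omega -> R) (c : R) : 0 < c -> finrv S Y ->
  ee S (fun w => Y w / c) = ee S Y / c.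
Proof.
move=> c0 fY; rewrite mulrC -eeZ ?invr_ge0 ?(ltW c0) //.
by congr ee; apply/funext => w; rewrite mulrC.
Qed.

Lemma finrv_div (Y : Omega -> R) (c : R) : finrv S Y -> finrv S (fun w => Y w / c).
Proof.
move=> fY; rewrite (_ : (fun w => _) = (fun w => c^-1 * Y w)); first exact: finrvZ.
by apply/funext => w; rewrite mulrC.
Qed.

Variables (N : nat) (X : 'I_N -> Omega -> R) (b r : R).
Hypotheses (rX : forall k, rv S (X k)) (b0 : 0 < b)
  (hb : ((b ^+ 2)%:E = \sum_(k < N) expect S (fun w => (X k w ^+ 2)%R))%E).

Let b20 : 0 < b ^+ 2. Proof. by rewrite exprn_gt0. Qed.

(** All summands of B_n^2 are nonnegative, so each is bounded by this finite sum. *)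
Lemma finrv_row_sqr k : finrv S (fun w => X k w ^+ 2).
Proof.
have rs j : rv S (fun w => X j w ^+ 2) := rv_comp (@sqr_C_lLip R) (rX j).
have E2 j : (0%:E <= expect S (fun w => (X j w ^+ 2)%R))%E.
  rewrite expect_rv // -(E0_cst S); apply: E0_mono => // [|w]; first exact: rv_cst.
  exact: sqr_ge0.
split => //; rewrite (_ : (fun w => _) = (fun w => X k w ^+ 2)); last first.
  by apply/funext => w; rewrite ger0_norm // sqr_ge0.
rewrite -expect_rv //; apply: (@le_lt_trans _ _ (b ^+ 2)%:E); last exact: ltry.
by rewrite hb (bigD1 k) //= leeDl // sume_ge0.
Qed.

Let fs := finrv_row_sqr.
Let fX k : finrv S (X k). Proof. exact: (finrv_sqr (rX k) (fs k)). Qed.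

Let sqr_div k : (fun w => (X k w / b) ^+ 2) = (fun w => X k w ^+ 2 / b ^+ 2).
Proof. by apply/funext => w; rewrite expr_div_n. Qed.

Lemma finrv_row_div_sqr k : finrv S (fun w => (X k w / b) ^+ 2).
Proof. by rewrite sqr_div; exact: finrv_div. Qed.

(** In terms of the scheme, one row lasts exactly unit time. *)
Lemma row_variance : \sum_(k < N) ee S (fun w => (X k w / b) ^+ 2) = 1.
Proof.
under eq_bigr do rewrite sqr_div ee_div //.
rewrite -mulr_suml; apply: (@mulIf _ (b ^+ 2)); first by rewrite gt_eqF.
rewrite divfK ?gt_eqF // mul1r; apply: EFin_inj; rewrite hb -sumEFin.
by apply: eq_bigr => i _; rewrite expect_fin.
Qed.

Lemma row_mean :
  (((\sum_(k < N) (`|expect S (X k)| + `|conj_expect S (X k)|)) * b^-1%:E)%E =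
  (\sum_(k < N) (`|ee S (fun w => X k w / b)| + `|ee S (fun w => - (X k w / b))|))%:E).
Proof.
have -> : (\sum_(k < N) (`|expect S (X k)| + `|conj_expect S (X k)|))%E =
    (\sum_(k < N) (`|ee S (X k)| + `|ee S (fun w => - X k w)|))%:E.
  rewrite -sumEFin; apply: eq_bigr => k _.
  by rewrite /conj_expect abseN !expect_fin //; exact: finrvN.
rewrite -EFinM mulr_suml; congr EFin; apply: eq_bigr => k _.
rewrite (_ : (fun w => - (X k w / b)) = (fun w => (- X k w) / b)); last first.
  by apply/funext => w; rewrite mulNr.
rewrite !ee_div //; last exact: finrvN.
by rewrite !normrM (ger0_norm (_ : 0 <= b^-1)) ?invr_ge0 ?(ltW b0) // mulrDl.
Qed.

Lemma row_variance_gap :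
  (((\sum_(k < N) `|r%:E * expect S (fun w => (X k w ^+ 2)%R) -
        conj_expect S (fun w => (X k w ^+ 2)%R)|) * (b ^+ 2)^-1%:E)%E =
  (\sum_(k < N) `|r * ee S (fun w => (X k w / b) ^+ 2)
     + ee S (fun w => - ((X k w / b) ^+ 2))|)%:E).
Proof.
have -> : (\sum_(k < N) `|r%:E * expect S (fun w => (X k w ^+ 2)%R) -
        conj_expect S (fun w => (X k w ^+ 2)%R)|)%E =
    (\sum_(k < N) `|r * ee S (fun w => X k w ^+ 2) + ee S (fun w => - (X k w ^+ 2))|)%:E.
  rewrite -sumEFin; apply: eq_bigr => k _.
  rewrite /conj_expect oppeK !expect_fin //; first exact: finrvN.
rewrite -EFinM mulr_suml; congr EFin; apply: eq_bigr => k _.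
rewrite (_ : (fun w => - ((X k w / b) ^+ 2)) =
    (fun w => (- (X k w ^+ 2)) / b ^+ 2)); last first.
  by apply/funext => w; rewrite mulNr expr_div_n.
rewrite sqr_div !ee_div //; last exact: finrvN.
by rewrite mulrA -mulrDl normrM (ger0_norm (_ : 0 <= (b ^+ 2)^-1)) // invr_ge0 ltW.
Qed.

Lemma row_lindeberg eps : 0 < eps ->
  (((b ^+ 2)^-1%:E * \sum_(k < N)
      expect S (fun w => Num.max (X k w ^+ 2 - eps * b ^+ 2)%R 0%R))%E =
  (\sum_(k < N) ee S (fun w => Num.max ((X k w / b) ^+ 2 - eps) 0))%:E).
Proof.
move=> eps0; have f k : finrv S (fun w => Num.max (X k w ^+ 2 - eps * b ^+ 2) 0).
  by apply: finrv_sqr_excess => //; rewrite mulr_gt0.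
under eq_bigr do rewrite expect_fin //.
rewrite sumEFin -EFinM mulrC mulr_suml; congr EFin; apply: eq_bigr => k _.
rewrite -ee_div //; congr ee; apply/funext => w.
rewrite expr_div_n maxr_pMl ?invr_ge0 ?(ltW b20) // mul0r mulrBl.
by rewrite mulfK // gt_eqF.
Qed.

End RowMoments.

Lemma cvge0_near_le (R : realType) (u : nat -> \bar R) (a : nat -> R) (w : R) :
  u n @[n --> \oo] --> 0%E -> (forall n, (1 <= n)%N -> u n = (a n)%:E) -> 0 < w ->
  \forall n \near \oo, a n <= w.
Proof.
move=> /fine_cvg/cvgrPdist_le H ua w0; near=> n.
have n1 : (1 <= n)%N by near: n; exists 1%N.
have : `|0 - fine (u n)| <= w by near: n; exact: H.
by rewrite ua //= sub0r normrN; apply: le_trans; exact: ler_norm.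
Unshelve. all: by end_near. Qed.

(** The condition on f matches the default entry of [scaled_row], the zero variable, with the
    default 0 in [psum_cyc]. *)
Lemma psum_scaled_row (R : realType) (d : measure_display) (Omega : measurableType d)
    (N : nat) (X : 'I_N -> Omega -> R) (b : R) (f : (Omega -> R) -> R) (p : nat) :
  f (fun=> 0) = 0 ->
  psum (fun j => f (scaled_row X b j)) (p * N)%N =
  p%:R * \sum_(i < N) f (fun w => X i w / b).
Proof.
move=> f0; rewrite -psum_cyc; congr psum; apply/funext => j.
by rewrite /scaled_row (cyc_map f) f0.
Qed.

(** * Convergence for bounded Lipschitz test functions *)

Section LipschitzTestFunctions.
Context (R : realType) (d : measure_display) (Omega : measurableType d).
Variables (S : sublinear_expectation R Omega).
Variables (kn : nat -> nat) (X : forall n : nat, 'I_(kn n) -> Omega -> R).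
Variables (B : nat -> R) (r : R).
Arguments X : clear implicits.
Hypotheses (hX : forall n, (1 <= n)%N -> independent_rvs S (X n))
  (hB : forall n, (1 <= n)%N ->
     ((B n ^+ 2)%:E =
      \sum_(k < kn n) expect S (fun w => (X n k w ^+ 2)%R))%E)
  (hB0 : forall n, (1 <= n)%N -> 0 < B n)
  (hLindeberg : forall eps : R, 0 < eps ->
     ((B n ^+ 2)^-1%:E *
      \sum_(k < kn n)
        expect S (fun w => Num.max (X n k w ^+ 2 - eps * B n ^+ 2)%R 0%R))%E
       @[n --> \oo] --> 0%E)
  (hr : 0 <= r <= 1)
  (hvar :
     ((\sum_(k < kn n)
        `|r%:E * expect S (fun w => (X n k w ^+ 2)%R) -
          conj_expect S (fun w => (X n k w ^+ 2)%R)|) *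
      (B n ^+ 2)^-1%:E)%E @[n --> \oo] --> 0%E)
  (hmean :
     ((\sum_(k < kn n)
        (`|expect S (X n k)| + `|conj_expect S (X n k)|)) *
      (B n)^-1%:E)%E @[n --> \oo] --> 0%E).

Let rX n : (1 <= n)%N -> forall k, rv S (X n k). Proof. by case/hX. Qed.

Let h n := scaled_row (X n) (B n).
(** The step error as a functional of a single variable, so that it can be mapped along the periodic
    row. *)
Let err eps (Y : Omega -> R) := step_error S (fun=> Y) r eps 0.
Let rowerr n eps := \sum_(k < kn n) err eps (fun w => X n k w / B n).

Let err0 eps : 0 < eps -> err eps (fun=> 0) = 0.
Proof.
move=> eps0; rewrite /err /step_error /step_length oppr0 expr0n /= oppr0 sub0r.
by rewrite !ee_cst max_r ?oppr_le0 ?(ltW eps0) // mulr0 !addr0 normr0 !addr0.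
Qed.

Let rh n j : (1 <= n)%N -> rv S (h n j).
Proof.
by move=> n1; apply: cycP; [exact: rv_zero|move=> i; apply: rv_div; exact: rX].
Qed.

Let fh n j : (1 <= n)%N -> finrv S (fun w => h n j w ^+ 2).
Proof.
move=> n1; apply: (@cycP _ _ _ _ _ (fun Y => finrv S (fun w => Y w ^+ 2))).
  by rewrite expr0n; exact: finrv_cst.
by move=> i; apply: (finrv_row_div_sqr (rX n1) (hB n1)).
Qed.

Let err_ge0 n eps k : (1 <= n)%N -> 0 < eps -> 0 <= err eps (fun w => X n k w / B n).
Proof.
move=> n1 eps0; apply: step_error_ge0 => // j.
  by apply: rv_div; exact: rX.
exact: (finrv_row_div_sqr (rX n1) (hB n1)).
Qed.

Let rowerr_small eps w : 0 < eps -> 0 < w -> \forall n \near \oo, rowerr n eps <= w.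
Proof.
move=> eps0 w0; have w3 : 0 < w / 3 by rewrite divr_gt0.
near=> n.
have n1 : (1 <= n)%N by near: n; exists 1%N.
have e1 : \sum_(k < kn n) (`|ee S (fun w => X n k w / B n)|
    + `|ee S (fun w => - (X n k w / B n))|) <= w / 3.
  near: n; apply: (cvge0_near_le hmean) => // n n1.
  exact: (row_mean (rX n1) (hB0 n1) (hB n1)).
have e2 : \sum_(k < kn n) `|r * ee S (fun w => (X n k w / B n) ^+ 2)
     + ee S (fun w => - ((X n k w / B n) ^+ 2))| <= w / 3.
  near: n; apply: (cvge0_near_le hvar) => // n n1.
  exact: (row_variance_gap r (rX n1) (hB0 n1) (hB n1)).
have e3 : \sum_(k < kn n) ee S (fun w => Num.max ((X n k w / B n) ^+ 2 - eps) 0) <= w / 3.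
  near: n; apply: (cvge0_near_le (hLindeberg eps0)) => // n n1.
  exact: (row_lindeberg (rX n1) (hB0 n1) (hB n1) eps0).
rewrite /rowerr /err /step_error /step_length !big_split /=.
by move: e1; rewrite big_split /=; lra.
Unshelve. all: by end_near. Qed.

Let psum_length n p : (1 <= n)%N -> psum (step_length S (h n)) (p * kn n)%N = p%:R.
Proof.
move=> n1; rewrite (psum_scaled_row (X n) (B n) (f := fun Y => ee S (fun w => Y w ^+ 2))).
  by rewrite (row_variance (rX n1) (hB0 n1) (hB n1)) mulr1.
by rewrite expr0n ee_cst.
Qed.

Let psum_error n eps p : (1 <= n)%N -> 0 < eps ->
  psum (step_error S (h n) r eps) (p * kn n)%N = p%:R * rowerr n eps.
Proof.
by move=> n1 eps0; rewrite (psum_scaled_row (X n) (B n) (f := err eps)) // err0.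
Qed.

Lemma clt_lipschitz (d' : measure_display) (Omega' : measurableType d')
    (S' : sublinear_expectation R Omega') (xi : Omega' -> R) (phi : R -> R) (K L : R) :
  Gnormal S' r 1 xi -> 0 < L -> (forall x, `|phi x| <= K) ->
  (forall x y, `|phi x - phi y| <= L * `|x - y|) ->
  fine (expect S (fun w => phi ((\sum_(k < kn n) X n k w) / B n))) @[n --> \oo]
    --> fine (expect S' (fun w => phi (xi w))).
Proof.
move=> [_ _ G] L0 phiK phiL.
have [_] := G phi (lip_C_lLip phiL); set u := (fun t x => fine _) => uP.
have -> : fine (expect S' (fun w => phi (xi w))) = u 1 0.
  by rewrite /u sqrtr1; congr (fine (expect _ _)); apply/funext => w; rewrite add0r mul1r.
apply: cvg_ultra => F FF ooF.
have F1 : \forall n \near F, (1 <= n)%N by apply: ooF; exists 1%N.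
have Frow eps w : 0 < eps -> 0 < w -> \forall n \near F, rowerr n eps <= w.
  by move=> eps0 w0; apply: ooF; exact: rowerr_small.
have r01 : 0 <= (1 : R) <= 1 by rewrite ler01 lexx.
have len0 n j : (1 <= n)%N -> 0 <= step_length S (h n) j.
  by move=> n1; apply: step_length_ge0 => i; exact: fh.
have er0 n eps j : (1 <= n)%N -> 0 < eps -> 0 <= step_error S (h n) r eps j.
  by move=> n1 eps0; apply: step_error_ge0 => // i; [exact: rh|exact: fh].
pose W n := backward S (h n) phi.
suff : W n (kn n) 0 @[n --> F] --> u 1 0.
  apply: cvg_trans; apply: near_eq_cvg; apply: filterS F1 => n n1.
  by rewrite (expect_row (hX n1) (hB0 n1) (ltW L0) phiK phiL).
have WK n : (1 <= n)%N -> forall k, _ := fun n1 k =>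
  backward_bounded_lip (fun j => rh j n1) phiK phiL k.
apply: (@scheme_cvg R F FF (fun n => step_length S (h n)) (fun n => step_error S (h n) r)
  _ _ _ _ _ W r 1 K L phi u kn) => //.
- by apply: filterS F1 => n n1 j; exact: len0.
- apply: filterS F1 => n n1 T; exists (Num.bound `|T| * kn n)%N.
  rewrite psum_length //; apply: le_lt_trans (ler_norm T) _.
  exact: archi_boundP.
(* A step is at most w / 2 plus its excess at level w / 2, and that excess is bounded by the error
   of the whole row. *)
- move=> w w0; have w2 : 0 < w / 2 by rewrite divr_gt0.
  near=> n; have n1 : (1 <= n)%N by near: n.
  have row : rowerr n (w / 2) <= w / 2 by near: n; exact: Frow.
  move=> j; apply: (le_trans (step_length_le (fun i => rh i n1) (fun i => fh i n1) j w2)).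
  suff : err (w / 2) (h n j) <= w / 2.
    rewrite /err /step_error /=.
    have := normr_ge0 (ee S (h n j)).
    have := normr_ge0 (ee S (fun w0 => - h n j w0)).
    have := normr_ge0 (r * step_length S (fun=> h n j) 0 + ee S (fun w0 => - h n j w0 ^+ 2)).
    lra.
  apply: (@cycP _ _ _ _ _ (fun Y => err (w / 2) Y <= w / 2)); first by rewrite err0 // ltW.
  move=> i; apply: le_trans row; rewrite /rowerr (bigD1 i) //= lerDl.
  by apply: sumr_ge0 => k _; exact: err_ge0.
- by apply: filterS F1 => n n1 eps j; exact: er0.
(* Since p > T, every step reached by time T lies within the first p periods, whose total error is p
   times the row error. *)
- move=> T eps w eps0 w0; pose p := Num.bound `|T|.
  have Tp : T < p%:R by apply: le_lt_trans (ler_norm T) _; exact: archi_boundP.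
  have p0 : 0 < p%:R + 1 :> R by rewrite ltr_wpDl.
  near=> n => k kT; have n1 : (1 <= n)%N by near: n.
  have row : rowerr n eps <= w / (p%:R + 1) by near: n; apply: Frow; rewrite ?divr_gt0.
  have kp : (k <= p * kn n)%N.
    rewrite leqNgt; apply/negP => /ltnW/(psum_le (fun j => len0 n j n1)).
    by rewrite psum_length // => /le_trans/(_ kT); rewrite leNgt Tp.
  apply: (le_trans (psum_le (fun j => er0 n eps j n1 eps0) kp)).
  rewrite psum_error //; apply: (@le_trans _ _ (p%:R * (w / (p%:R + 1)))).
    by rewrite ler_wpM2l.
  by rewrite mulrA ler_pdivrMr // mulrC ler_wpM2l ?(ltW w0) // lerDl.
- apply: filterS F1 => n n1.
  exact: (backward_substep r (fun j => rh j n1) (fun j => fh j n1) phiK phiL).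
- apply: filterS F1 => n n1.
  exact: (backwardN_substep r (fun j => rh j n1) (fun j => fh j n1) phiK phiL).
- by apply: filterS F1 => n n1 k; case: (WK n n1 k).
- by apply: filterS F1 => n n1 k; case: (WK n n1 k).
- by apply: nearW => n x.
- by apply: filterS F1 => n n1; have := psum_length 1 n1; rewrite mul1n.
Unshelve. all: by end_near. Qed.

End LipschitzTestFunctions.

(** * Bounded continuous test functions *)

Section BoundedContinuous.
Context (R : realType).
Implicit Types (phi : R -> R) (K M eps : R).

(** Compactness is used for x alone; y may leave the segment. *)
Lemma continuous_segment_modulus phi M eps : continuous phi -> 0 < eps ->
  exists2 del, 0 < del &
    forall x y, `|x| <= M -> `|x - y| <= del -> `|phi x - phi y| <= eps.
Proof.
move=> cphi eps0; have /compact_near_coveringP cM := @segment_compact R (- M) M.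
pose P (h x : R) := forall y, `|x - y| <= `|h| -> `|phi x - phi y| <= eps.
have : \forall h \near (0 : R), `[- M, M]%classic `<=` P h.
  apply: (cM R (nbhs (0 : R)) P) => x _.
  have e2 : 0 < eps / 2 by rewrite divr_gt0.
  have /cvgrPdist_le/(_ _ e2)/nbhs_ballP[r /= r0 H] := cphi x.
  have r2 : 0 < r / 2 by rewrite divr_gt0.
  exists (ball x (r / 2), ball 0 (r / 2)); first by split; exact: nbhsx_ballx.
  move=> [x' h] [/= bx bh] y xy; move: bx bh; rewrite /ball/= sub0r normrN => bx bh.
  have h1 : `|phi x - phi x'| <= eps / 2 by apply: H; rewrite /ball/=; lra.
  have h2 : `|phi x - phi y| <= eps / 2.
    apply: H; rewrite /ball/= (_ : x - y = (x - x') + (x' - y)); last ring.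
    by apply: (le_lt_trans (ler_normD _ _)); lra.
  by move: h1 h2; rewrite !ler_norml; lra.
move=> /nbhs_ballP[r /= r0 H]; have r2 : 0 < r / 2 by rewrite divr_gt0.
exists (r / 2) => // x y xM xy; apply: (H (r / 2) _ x _ y).
- by rewrite /ball/= sub0r normrN gtr0_norm //; lra.
- by rewrite /= in_itv/= -ler_norml.
- by rewrite (gtr0_norm r2).
Qed.

(** A Lipschitz substitute for the indicator of a tail, to which the convergence for Lipschitz
    functions applies; it is 0 for |x| <= M and 1 for |x| >= M + 1. *)
Definition tail_cutoff M (x : R) : R := Num.min 1 (Num.max (`|x| - M) 0).

Lemma tail_cutoff_lip M x y : `|tail_cutoff M x - tail_cutoff M y| <= 1 * `|x - y|.
Proof.
have min_lip (u v : R) : `|Num.min 1 u - Num.min 1 v| <= `|u - v|.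
  rewrite /Num.min; case: ifPn; case: ifPn; rewrite -?leNgt => h1 h2 //.
  - by rewrite subrr normr0.
  - by rewrite ger0_norm ?subr_ge0 // ler_normr; apply/orP; left; lra.
  - by rewrite ler0_norm ?subr_le0 ?ler_normr //; apply/orP; right; lra.
rewrite mul1r; apply: le_trans (min_lip _ _) _.
exact: le_trans (maxB_lip _ _ _) (ler_dist_dist x y).
Qed.

Lemma tail_cutoff_ge0 M x : 0 <= tail_cutoff M x.
Proof. by rewrite le_min ler01 le_max lexx orbT. Qed.

Lemma tail_cutoff_le1 M x : tail_cutoff M x <= 1.
Proof. by rewrite ge_min lexx. Qed.

Lemma tail_cutoff_norm_le1 M x : `|tail_cutoff M x| <= 1.
Proof. by rewrite ger0_norm ?tail_cutoff_ge0 // tail_cutoff_le1. Qed.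

(** The pointwise form of Chebyshev's inequality. *)
Lemma tail_cutoff_le_sqr M x : 0 < M -> tail_cutoff M x <= x ^+ 2 / M ^+ 2.
Proof.
move=> M0; case: (lerP `|x| M) => xM.
  rewrite /tail_cutoff max_r ?subr_le0 // min_r //.
  by rewrite divr_ge0 ?sqr_ge0 // exprn_ge0 // ltW.
apply: (le_trans (tail_cutoff_le1 _ _)); rewrite ler_pdivlMr ?exprn_gt0 // mul1r.
by rewrite -[leRHS]real_normK ?num_real // lerXn2r ?nnegrE // ltW.
Qed.

(** In the inf-convolution, a competitor farther than [del] pays at least 2 K and cannot beat phi x;
    a nearer one differs by at most eps if |x| <= M + 1. Beyond that range the cutoff is 1 and the
    trivial bound 2 K suffices. *)
Lemma lipschitz_approx phi K M eps : continuous phi -> 0 < K -> 0 < eps ->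
  (forall x, `|phi x| <= K) ->
  exists g : R -> R, exists2 L, 0 < L &
    [/\ forall x, `|g x| <= K, forall x y, `|g x - g y| <= L * `|x - y|
      & forall x, `|phi x - g x| <= 2 * K * tail_cutoff M x + eps].
Proof.
move=> cphi K0 eps0 phiK.
have [del del0 H] := continuous_segment_modulus (M + 1) cphi eps0.
(* [g] is the inf-convolution of [phi] with [L |.|]. *)
pose L := 2 * K / del.
have L0 : 0 < L by rewrite divr_gt0 // mulr_gt0.
pose A x := [set phi y + L * `|x - y| | y in [set: R]].
have AK x : lbound (A x) (- K).
  move=> _ [y _ <-]; have := phiK y; rewrite ler_norml => /andP[h _].
  by rewrite -[- K]addr0; apply: lerD => //; rewrite mulr_ge0 // ltW.
have A0 x : A x !=set0 by exists (phi x + L * `|x - x|); exists x.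
have gle x y : inf (A x) <= phi y + L * `|x - y|.
  by apply: ge_inf; [exists (- K); exact: AK|exists y].
exists (fun x => inf (A x)), L => //; split.
- move=> x; rewrite ler_norml lb_le_inf //=.
  apply: (le_trans (gle x x)); rewrite subrr normr0 mulr0 addr0.
  exact: le_trans (ler_norm _) (phiK x).
- have Hle x y : inf (A x) - L * `|x - y| <= inf (A y).
    apply: lb_le_inf => // _ [z _ <-]; rewrite lerBlDr -addrA -mulrDr.
    apply: (le_trans (gle x z)); rewrite lerD2l ler_wpM2l ?(ltW L0) //.
    by rewrite (_ : x - z = (y - z) + (x - y)) ?ler_normD //; ring.
  move=> x y; have := Hle x y; have := Hle y x.
  by rewrite (distrC y x) ler_norml; lra.
- move=> x; have gphi : inf (A x) <= phi x.
    by have := gle x x; rewrite subrr normr0 mulr0 addr0.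
  rewrite ger0_norm ?subr_ge0 //.
  have tc := tail_cutoff_ge0 M x.
  have gK : - K <= inf (A x) by exact: lb_le_inf.
  have pK := phiK x; rewrite ler_norml in pK.
  case: (lerP `|x| (M + 1)) => xM; last first.
    rewrite /tail_cutoff max_l; last lra.
    by rewrite min_l; lra.
  suff : phi x - eps <= inf (A x) by have := mulr_ge0 (ltW K0) tc; lra.
  apply: lb_le_inf => // _ [y _ <-].
  case: (lerP `|x - y| del) => xy.
    have := H x y xM xy; have := mulr_ge0 (ltW L0) (normr_ge0 (x - y)).
    by rewrite ler_norml; lra.
  have h1 : L * del <= L * `|x - y| by rewrite ler_wpM2l ?(ltW xy) // ltW.
  have h2 : L * del = 2 * K by rewrite /L divfK // gt_eqF.
  by have := phiK y; rewrite ler_norml; lra.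
Qed.

End BoundedContinuous.

(** Z may lie outside H; it is enclosed between g - q and g + q, and E[g] <= E[g - q] + E[q] gives
    the lower bound. *)
Lemma expect_approx (R : realType) (d : measure_display) (Omega : measurableType d)
    (S : sublinear_expectation R Omega) (Z g q : Omega -> R) :
  finrv S g -> finrv S q -> (forall w, `|Z w - g w| <= q w) ->
  expect S Z \is a fin_num /\ `|fine (expect S Z) - ee S g| <= ee S q.
Proof.
move=> fg fq Zg.
have fqN := finrvN fq; have fl := finrvD fg fqN; have fu := finrvD fg fq.
have /(expect_sandwich fl fu) : forall w, g w + - q w <= Z w <= g w + q w.
  by move=> w; have := Zg w; rewrite ler_norml; lra.
case: (expect S Z) => [z| |] /=; rewrite ?lee_fin ?leye_eq ?leeNy_eq ?andbF //.
move=> zz; split=> //=; have h1 := eeD fg fq; have h2 := eeD fl fq.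
move: h2; rewrite (_ : (fun w => g w + - q w + q w) = g).
  by rewrite ler_norml; lra.
by apply/funext => w; rewrite addrNK.
Qed.

Theorem theorem2p1 (R : realType)
    (d : measure_display) (Omega : measurableType d)
    (S : sublinear_expectation R Omega)
    (kn : nat -> nat) (X : forall n : nat, 'I_(kn n) -> Omega -> R)
    (B : nat -> R) (r : R)
    (hX : forall n, (1 <= n)%N -> independent_rvs S (X n))
    (hB : forall n, (1 <= n)%N ->
       ((B n ^+ 2)%:E =
        \sum_(k < kn n) expect S (fun w => (X n k w ^+ 2)%R))%E)
    (hB0 : forall n, (1 <= n)%N -> 0 < B n)
    (hLindeberg : forall eps : R, 0 < eps ->
       ((B n ^+ 2)^-1%:E *
        \sum_(k < kn n)
          expect S (fun w => Num.max (X n k w ^+ 2 - eps * B n ^+ 2)%R 0%R))%E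
         @[n --> \oo] --> 0%E)
    (hr : 0 <= r <= 1)
    (hvar :
       ((\sum_(k < kn n)
          `|r%:E * expect S (fun w => (X n k w ^+ 2)%R) -
            conj_expect S (fun w => (X n k w ^+ 2)%R)|) *
        (B n ^+ 2)^-1%:E)%E @[n --> \oo] --> 0%E)
    (hmean :
       ((\sum_(k < kn n)
          (`|expect S (X n k)| + `|conj_expect S (X n k)|)) *
        (B n)^-1%:E)%E @[n --> \oo] --> 0%E)
    (d' : measure_display) (Omega' : measurableType d')
    (S' : sublinear_expectation R Omega') (xi : Omega' -> R)
    (hxi : Gnormal S' r 1 xi)
    (phi : R -> R) (hphib : bounded_fun phi) (hphic : continuous phi) :
  expect S (fun w => phi ((\sum_(k < kn n) X n k w) / B n)) @[n --> \oo]
    --> expect S' (fun w => phi (xi w)).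
Proof.
have [K K0 phiK] : exists2 K, 0 < K & forall x, `|phi x| <= K.
  case: hphib => K0 [_ HK]; exists (`|K0| + 1); first by rewrite ltr_wpDl.
  move=> x; apply: (HK (`|K0| + 1)) => //.
  by rewrite (le_lt_trans (ler_norm _)) // ltrDl.
have [_ rxi G] := hxi.
(* The G-normal law has finite values for every test function in C_{l,Lip}; the square at t = 1, x =
   0 yields the second moment. *)
have fxi2 : finrv S' (fun w => xi w ^+ 2).
  have rxi2 : rv S' (fun w => xi w ^+ 2) := rv_comp (@sqr_C_lLip R) rxi.
  have [/(_ 1 0 ler01) + _] := G _ (@sqr_C_lLip R).
  rewrite (_ : (fun w => _) = (fun w => xi w ^+ 2)); last first.
    by apply/funext => w; rewrite sqrtr1 mul1r add0r.
  rewrite expect_rv // => fin; split => //.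
  rewrite (_ : (fun w => _) = (fun w => xi w ^+ 2)); last first.
    by apply/funext => w; rewrite ger0_norm // sqr_ge0.
  by rewrite ltey_eq fin.
pose Z n w := (\sum_(k < kn n) X n k w) / B n.
have rZ n : (1 <= n)%N -> rv S (Z n).
  by move=> n1; apply: rv_div; apply: rv_sum => k; case: (hX n n1).
have approx (d0 : measure_display) (Om : measurableType d0)
    (S0 : sublinear_expectation R Om) (Y : Om -> R) g L M eps :
    rv S0 Y -> (forall x, `|g x| <= K) -> (forall x y, `|g x - g y| <= L * `|x - y|) ->
    (forall x, `|phi x - g x| <= 2 * K * tail_cutoff M x + eps) ->
    expect S0 (fun w => phi (Y w)) \is a fin_num /\
    `|fine (expect S0 (fun w => phi (Y w))) - fine (expect S0 (fun w => g (Y w)))|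
      <= 2 * K * fine (expect S0 (fun w => tail_cutoff M (Y w))) + eps.
  move=> rY gK gL phig.
  have fg : finrv S0 (fun w => g (Y w)) by apply: finrv_bounded (lip_C_lLip gL) gK rY.
  have ft : finrv S0 (fun w => tail_cutoff M (Y w)).
    exact: finrv_bounded (lip_C_lLip (tail_cutoff_lip M)) (tail_cutoff_norm_le1 M) rY.
  have ft2 := finrvZ (2 * K) ft.
  have [fin le] := expect_approx fg (finrvD ft2 (finrv_cst S0 eps))
    (fun w => phig (Y w)).
  split=> //; rewrite (expect_fin fg) (expect_fin ft) /=; apply: (le_trans le).
  by rewrite eeDc // eeZ ?mulr_ge0 ?(ltW K0).
have tail_fin M : fine (expect S' (fun w => tail_cutoff M (xi w))) =
    ee S' (fun w => tail_cutoff M (xi w)) /\ finrv S' (fun w => tail_cutoff M (xi w)).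
  suff ft : finrv S' (fun w => tail_cutoff M (xi w)) by rewrite (expect_fin ft).
  exact: finrv_bounded (lip_C_lLip (tail_cutoff_lip M)) (tail_cutoff_norm_le1 M) rxi.
have V0 : 0 <= ee S' (fun w => xi w ^+ 2).
  rewrite -[leLHS](ee_cst S'); apply: ee_le => // [|w]; first exact: finrv_cst.
  exact: sqr_ge0.
set V := ee _ _ in V0.
have fin_xi : expect S' (fun w => phi (xi w)) \is a fin_num.
  have [g [L L0 [gK gL phig]]] := lipschitz_approx 0 hphic K0 ltr01 phiK.
  by case: (approx _ _ S' xi g L 0 1 rxi gK gL phig).
rewrite -(fineK fin_xi); apply/fine_cvgP; split.
  have [g [L L0 [gK gL phig]]] := lipschitz_approx 0 hphic K0 ltr01 phiK.
  exists 1%N => // n /= n1.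
  by case: (approx _ _ S (Z n) g L 0 1 (rZ n n1) gK gL phig).
apply/cvgrPdist_le => e e0.
have e8 : 0 < e / 8 by rewrite divr_gt0.
(* By Chebyshev the tail of xi costs at most 2 K V / M^2; as M >= 1 this is at most 2 K V / M <= e /
   8. *)
pose M := 16 * K * V / e + 1.
have M1 : 1 <= M by rewrite lerDr divr_ge0 ?(ltW e0) // !mulr_ge0 // ltW.
have M0 : 0 < M by exact: lt_le_trans M1.
have [g [L L0 [gK gL phig]]] := lipschitz_approx M hphic K0 e8 phiK.
have tailV : 2 * K * fine (expect S' (fun w => tail_cutoff M (xi w))) <= e / 8.
  have [-> ft] := tail_fin M.
  have h1 : ee S' (fun w => tail_cutoff M (xi w)) <= V / M ^+ 2.
    rewrite /V -ee_div ?exprn_gt0 //; apply: ee_le => // [|w]; first exact: finrv_div.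
    exact: tail_cutoff_le_sqr.
  have h2 : V / M ^+ 2 <= V / M.
    apply: ler_wpM2l => //; rewrite lef_pV2 ?posrE ?exprn_gt0 //.
    by rewrite expr2 ler_peMl // ltW.
  have h3 : 2 * K * (V / M) <= e / 8.
    rewrite mulrA ler_pdivrMr // /M mulrDr mulr1.
    rewrite (_ : e / 8 * (16 * K * V / e) = 2 * K * V); first lra.
    by field; rewrite gt_eqF.
  have := ler_wpM2l (mulr_ge0 (ler0n R 2) (ltW K0)) (le_trans h1 h2); lra.
have tail_cvg := clt_lipschitz hX hB hB0 hLindeberg hr hvar hmean hxi ltr01
  (tail_cutoff_norm_le1 M) (tail_cutoff_lip M).
have g_cvg := clt_lipschitz hX hB hB0 hLindeberg hr hvar hmean hxi L0 gK gL.
have eK : 0 < e / (16 * K) by rewrite divr_gt0 // mulr_gt0.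
near=> n; have n1 : (1 <= n)%N by near: n; exists 1%N.
have a1 : `|fine (expect S' (fun w => g (xi w))) -
    fine (expect S (fun w => g (Z n w)))| <= e / 8.
  by near: n; move/cvgrPdist_le : g_cvg => /(_ _ e8).
have a2 : `|fine (expect S' (fun w => tail_cutoff M (xi w))) -
    fine (expect S (fun w => tail_cutoff M (Z n w)))| <= e / (16 * K).
  by near: n; move/cvgrPdist_le : tail_cvg => /(_ _ eK).
have [_ a3] := approx _ _ S (Z n) g L M (e / 8) (rZ n n1) gK gL phig.
have [_ a4] := approx _ _ S' xi g L M (e / 8) rxi gK gL phig.
(* Tightness of the rows: their tail exceeds that of xi by at most e / (16 K), hence the cost is at
   most e / 8 + e / 8. *)
have a5 : 2 * K * fine (expect S (fun w => tail_cutoff M (Z n w))) <= e / 4.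
  have K2 : 0 <= 2 * K by rewrite mulr_ge0 // ltW.
  move: a2; rewrite ler_norml => /andP[a2 _].
  have := ler_wpM2l K2 a2.
  rewrite mulrN (_ : 2 * K * (e / (16 * K)) = e / 8); last by field; rewrite gt_eqF.
  by clear -tailV; lra.
rewrite /comp -/(Z n) -[fun w => phi (_ / _)]/(fun w => phi (Z n w)).
(* Replacing phi by g costs 3 e / 8 for the row and 2 e / 8 for xi, and the convergence for g costs
   e / 8. *)
by move: a1 a3 a4; rewrite !ler_norml; clear -a5 tailV e0; lra.
Unshelve. all: by end_near. Qed.
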